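(* For every homology cylinder $M\in\mathcal{IC}$ over $\Sigma_{g,1}$, the image of $\tilde\alpha(M)$ under the homomorphism $K_1(\widehat{\mathbb{Q}\pi})\to K_1(\widehat{\mathbb{Q}H_{\mathbb{Z}}})$ induced by the natural ring homomorphism $\widehat{\mathbb{Q}\pi}\to\widehat{\mathbb{Q}H_{\mathbb{Z}}}$ equals the image of $\alpha(M)\in1+IH_{\mathbb{Z}}$ under the natural inclusion $1+IH_{\mathbb{Z}}\to\widehat{\mathbb{Q}H_{\mathbb{Z}}}^\times\cong K_1(\widehat{\mathbb{Q}H_{\mathbb{Z}}})$. That is, the square formed by $\tilde\alpha\colon\mathcal{IC}\to K_1(\widehat{\mathbb{Q}\pi})$, $\alpha\colon\mathcal{IC}\to1+IH_{\mathbb{Z}}$ and these two homomorphisms commutes.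
   Context: Notation. $\Sigma_{g,1}$: compact connected oriented surface of genus $g$ with one boundary component; $\pi=\pi_1(\Sigma_{g,1},* )$; $H_{\mathbb{Z}}=H_1(\Sigma_{g,1};\mathbb{Z})$ with intersection form $x\cdot y$; $\widehat{\mathbb{Q}\pi}=\varprojlim_n\mathbb{Q}\pi/I^n$, $I$ the augmentation ideal; $\hat I^n=\operatorname{Ker}(\widehat{\mathbb{Q}\pi}\to\mathbb{Q}\pi/I^n)$. $IH_{\mathbb{Z}}$ is the augmentation ideal of $\mathbb{Z}H_{\mathbb{Z}}$; $\widehat{\mathbb{Q}H_{\mathbb{Z}}}$ is the completion of $\mathbb{Q}H_{\mathbb{Z}}$ with respect to its augmentation ideal; $Q(\mathbb{Z}H_{\mathbb{Z}})$ is the field of fractions of $\mathbb{Z}H_{\mathbb{Z}}$. Homology cylinders. A homology cobordism over $\Sigma_{g,1}$ is an equivalence class (orientation-preserving homeomorphisms compatible with the markings) of pairs $(M,i)$, $M$ a compact oriented 3-manifold, $i\colon\partial(\Sigma_{g,1}\times[-1,1])\to\partial M$ an orientation-preserving homeomorphism, such that the restrictions $i_\pm$ of $i$ to $\Sigma_{g,1}\times\{\pm1\}$ induce isomorphisms $H_{\mathbb{Z}}\to H_1(M;\mathbb{Z})$; it is a homology cylinder if these coincide. $\mathcal{IC}$ is the monoid of homology cylinders; $\partial_-M=i_-(\Sigma_{g,1})$. By Stallings' theorem $i_\pm$ induce isomorphisms $\pi/\pi(n)\cong\pi_1M/\pi_1M(n)$ ($G(n)$: lower central series, $G(1)=G$),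 and $\widehat{\mathbb{Q}\pi}\cong\widehat{\mathbb{Q}\pi_1M}$. Torsions. Let $R$ be a local ring or commutative PID and $\rho\colon\mathbb{Z}\pi_1M\to R$ a ring homomorphism. Triangulate $(M,\partial_-M)$, let $p\colon\tilde M\to M$ be the universal cover, $C_*(M,\partial_-M;R)=C_*(\tilde M,p^{-1}(\partial_-M);\mathbb{Z})\otimes_{\mathbb{Z}\pi_1M}R$, with right action $c\cdot\gamma=t_\gamma^{-1}(c)$ ($t_\gamma$ the deck transformation of $\gamma$) and left action on $R$ via $\rho$. Assume it is acyclic (as it is in the two cases below). Orders and orientations of the cells of $M\setminus\partial_-M$ (double choice $oo$) and a family $\tilde E$ of lifts, one of each cell, give a basis $c=\{c_i\}$; the torsion is $\prod_i[b_i\tilde b_{i-1}/c_i]^{(-1)^{i+1}}\in K_1(R)$ ($b_i$ a basis of the $i$-boundaries, $\tilde b_{i-1}$ a lift of $b_{i-1}$ to $C_i$, $[b/c]$ the matrix expressing $b$ in terms of $c$). Multiplied by the sign of the torsion of $C_*(M,\partial_-M;\mathbb{Q})$ based by $oo$, it becomes independent of $oo$; denote it $\tau^\rho(M,\partial_-M,\tilde E)\in K_1(R)$. Let $\tilde\rho\colon\mathbb{Z}\pi_1M\to\widehat{\mathbb{Q}\pi_1M}\cong\widehat{\mathbb{Q}\pi}$ and $\rho\colon\mathbb{Z}\pi_1M\to\mathbb{Z}H_1(M;\mathbb{Z})\cong\mathbb{Z}H_{\mathbb{Z}}\to Q(\mathbb{Z}H_{\mathbb{Z}})$, the isomorphisms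 induced by $i_-$. Let $\tilde E$ represent the preferred Euler structure $\xi_0$ of Massuyeau–Meilhan; equivalently, $\tilde E$ is such that the image of $\tau^{\tilde\rho}(M,\partial_-M,\tilde E)$ in $K_1(\widehat{\mathbb{Q}\pi}/\hat I^2)$ is $\tilde\rho(-\tfrac12C(\tau_1(M)))$, where $\tilde\rho([\gamma])$ is the class of the unit $\gamma\in\pi$, $\tau_1(M)\in\operatorname{Hom}(H_{\mathbb{Z}},\pi(2)/\pi(3))\cong H_{\mathbb{Z}}\otimes L_2(H_{\mathbb{Z}})\subset H_{\mathbb{Z}}^{\otimes3}$ is $[x]\mapsto((i_-)_*^{-1}(i_+)_*(x))x^{-1}$ (using $H_{\mathbb{Z}}\cong H_{\mathbb{Z}}^*$, $x\mapsto(x\cdot-)$, and $[x,y]=x\otimes y-y\otimes x$), and $C(x\otimes x_1\otimes x_2)=(x\cdot x_1)x_2$. For such $\tilde E$ set $\tilde\alpha(M)=\tau^{\tilde\rho}(M,\partial_-M,\tilde E)\in K_1(\widehat{\mathbb{Q}\pi})$ and $\alpha(M)=\tau^{\rho}(M,\partial_-M,\tilde E)\in K_1(Q(\mathbb{Z}H_{\mathbb{Z}}))$; these do not depend on the choice. Under $\det\colon K_1(Q(\mathbb{Z}H_{\mathbb{Z}}))\cong Q(\mathbb{Z}H_{\mathbb{Z}})^\times$, $\alpha(M)$ is known to lie in $1+IH_{\mathbb{Z}}\subset\mathbb{Z}H_{\mathbb{Z}}$, and is regarded as an element of this set. *)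

(* Defs.v *)
From HB Require Import structures.
From mathcomp Require Import all_boot all_order all_algebra finmap generic_quotient ring_quotient.
From mathcomp Require Import all_classical all_reals all_analysis.
From mathcomp Require Import -(notations) monalg.
From mathcomp Require Import ring lra.

Set Implicit Arguments.
Unset Strict Implicit.
Unset Printing Implicit Defensive.

Import Order.TTheory GRing.Theory Num.Theory.
Import numFieldNormedType.Exports.
Local Open Scope classical_set_scope.
Local Open Scope ring_scope.

Section FreeModule.
Context (K : choiceType) (A V : zmodType).
Implicit Types (F : K -> {additive A -> V}) (x y : malg K A).

Definition mlin F x : V := \sum_(k <- msupp x) F k (mcoeff k x).

Lemma mlinw F x (d : {fset K}) : (msupp x `<=` d)%fset ->
  mlin F x = \sum_(k <- d) F k (mcoeff k x).
Proof.
move=> xd; rewrite /mlin (big_fset_incl _ xd) //= => k _ /mcoeff_outdom ->.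
by rewrite raddf0.
Qed.

Lemma mlin_is_zmod_morphism F : zmod_morphism (mlin F).
Proof.
move=> x y; have xyd : (msupp (x - y) `<=` msupp x `|` msupp y)%fset.
  by apply: fsubset_trans (msuppB_le _ _) _.
rewrite (mlinw F xyd) (mlinw F (fsubsetUl (msupp x) (msupp y))).
rewrite (mlinw F (fsubsetUr (msupp x) (msupp y))) -sumrB.
by apply: eq_bigr => k _; rewrite mcoeffB raddfB.
Qed.

HB.instance Definition _ F :=
  GRing.isZmodMorphism.Build (malg K A) V (mlin F) (mlin_is_zmod_morphism F).

Lemma mlinU F k a : mlin F (mkmalgU k a) = F k a.
Proof. by rewrite (mlinw F (msuppU_le)) big_seq_fset1 mcoeffUU. Qed.

Lemma malg_additive_ext (f f' : {additive malg K A -> V}) :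
  (forall k a, f (mkmalgU k a) = f' (mkmalgU k a)) -> f =1 f'.
Proof.
by move=> ff' x; rewrite (monalgE x) !raddf_sum; apply: eq_bigr => k _.
Qed.

End FreeModule.

Section GroupRing.
Context (R : nzRingType) (G : groupType).

Definition gring := malg G R.
HB.instance Definition _ := GRing.Zmodule.on gring.

Implicit Types x y z : gring.

Definition gscal (g : G) (c : R) : gring := mkmalgU g c.

Definition gmulUU (g : G) (c : R) (h : G) (d : R) : gring :=
  gscal (g * h)%g (c * d).
Fact gmulUU_subproof g c h : zmod_morphism (gmulUU g c h).
Proof. by move=> a b; rewrite /gmulUU mulrBr /gscal monalgUB. Qed.
HB.instance Definition _ g c h := GRing.isZmodMorphism.Build R gring
  (gmulUU g c h) (gmulUU_subproof g c h).

Definition gmulUl (y : gring) (g : G) (c : R) : gring :=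
  mlin (gmulUU g c) y.
Fact gmulUl_subproof y g : zmod_morphism (gmulUl y g).
Proof.
move=> a b; rewrite /gmulUl /mlin -sumrB; apply: eq_bigr => k _ /=.
by rewrite /gmulUU mulrBl /gscal monalgUB.
Qed.
HB.instance Definition _ y g := GRing.isZmodMorphism.Build R gring
  (gmulUl y g) (gmulUl_subproof y g).

(** Convolution: (sum_g a_g g) (sum_h b_h h) = sum_(g,h) a_g b_h gh. *)
Definition gmul x y : gring := mlin (gmulUl y) x.

Lemma gmulBl y : zmod_morphism (gmul^~ y).
Proof. by move=> a b; rewrite /gmul raddfB. Qed.

Lemma gmulBr x : zmod_morphism (gmul x).
Proof.
move=> a b; rewrite /gmul /mlin -sumrB; apply: eq_bigr => k _ /=.
by rewrite /gmulUl raddfB.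
Qed.

Lemma gmulU g c h d : gmul (gscal g c) (gscal h d) = gscal (g * h)%g (c * d).
Proof. by rewrite /gmul mlinU /= /gmulUl mlinU. Qed.

Lemma gmulDl : left_distributive gmul +%R.
Proof. by move=> a b y; rewrite /gmul raddfD. Qed.

Lemma gmulDr : right_distributive gmul +%R.
Proof.
move=> x a b; have B := gmulBr x.
have N t : gmul x (- t) = - gmul x t.
  by rewrite -[- t in LHS]sub0r B -{1}(subrr 0) B subrr sub0r.
by rewrite -[b]opprK B N !opprK.
Qed.

Lemma gring_ind (P : gring -> Prop) :
  (forall g c, P (gscal g c)) -> (forall x y, P x -> P y -> P (x + y)) ->
  forall x, P x.
Proof.
move=> PU PD x; rewrite (monalgE x).
elim/big_rec: _ => [|g y _ Py]; last exact: PD.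
by rewrite -(monalgU0 (1%g : G)); exact: PU.
Qed.

Lemma gmulA : associative gmul.
Proof.
move=> x y z; elim/gring_ind: x => [g c|a b IHa IHb]; last first.
  by rewrite !gmulDl IHa IHb.
elim/gring_ind: y => [h d|a b IHa IHb]; last by rewrite !(gmulDl, gmulDr) IHa IHb.
elim/gring_ind: z => [k e|a b IHa IHb]; last by rewrite !gmulDr IHa IHb.
by rewrite !gmulU mulrA mulgA.
Qed.

Lemma gmul1 : left_id (gscal 1%g 1) gmul.
Proof.
elim/gring_ind => [g c|a b IHa IHb]; last by rewrite gmulDr IHa IHb.
by rewrite gmulU mul1r mul1g.
Qed.

Lemma gmulr1 : right_id (gscal 1%g 1) gmul.
Proof.
elim/gring_ind => [g c|a b IHa IHb]; last by rewrite gmulDl IHa IHb.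
by rewrite gmulU mulr1 mulg1.
Qed.

Lemma gone_neq0 : gscal 1%g 1 != 0.
Proof. by rewrite /gscal monalgU_eq0 oner_eq0. Qed.

HB.instance Definition _ := GRing.Zmodule_isNzRing.Build gring
  gmulA gmul1 gmulr1 gmulDl gmulDr gone_neq0.

Definition gin (g : G) : gring := gscal g 1.

Definition gaugc (g : G) : {additive R -> R} := idfun.
Definition gaug : gring -> R := mlin gaugc.
HB.instance Definition _ := GRing.Additive.on gaug.

Lemma gaugU g c : gaug (gscal g c) = c. Proof. by rewrite /gaug mlinU. Qed.

Lemma gaug_is_monoid_morphism : monoid_morphism gaug.
Proof.
split; first by rewrite gaugU.
move=> x y; elim/gring_ind: x => [g c|a b IHa IHb]; last first.
  by rewrite mulrDl !raddfD /= mulrDl IHa IHb.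
elim/gring_ind: y => [h d|a b IHa IHb]; last by rewrite mulrDr !raddfD /= mulrDr IHa IHb.
by rewrite [_ * _]gmulU !gaugU.
Qed.
HB.instance Definition _ :=
  GRing.isMonoidMorphism.Build gring R gaug gaug_is_monoid_morphism.

End GroupRing.

Section GroupRingMap.
Context (R R' : nzRingType) (G G' : groupType).
Context (f : {rmorphism R -> R'}) (phi : {multiplicative G -> G'}).

Definition gmapU (g : G) (c : R) : gring R' G' := gscal (phi g) (f c).
Fact gmapU_subproof g : zmod_morphism (gmapU g).
Proof. by move=> a b; rewrite /gmapU rmorphB /gscal monalgUB. Qed.
HB.instance Definition _ g := GRing.isZmodMorphism.Build R (gring R' G')
  (gmapU g) (gmapU_subproof g).

Definition gmap : gring R G -> gring R' G' := mlin gmapU.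
HB.instance Definition _ := GRing.Additive.on gmap.

Lemma gmap_gscal g c : gmap (gscal g c) = gscal (phi g) (f c).
Proof. by rewrite /gmap mlinU. Qed.

Lemma ghom1 : phi 1%g = 1%g.
Proof. by apply: (mulgI (phi 1%g)); rewrite -gmulfM ?mulg1. Qed.

Lemma gmap_is_monoid_morphism : monoid_morphism gmap.
Proof.
split; first by rewrite gmap_gscal ghom1 rmorph1.
move=> x y; elim/gring_ind: x => [g c|a b IHa IHb]; last first.
  by rewrite mulrDl !raddfD /= mulrDl IHa IHb.
elim/gring_ind: y => [h d|a b IHa IHb]; last by rewrite mulrDr !raddfD /= mulrDr IHa IHb.
by rewrite [_ * _]gmulU !gmap_gscal gmulfM rmorphM [RHS]gmulU.
Qed.
HB.instance Definition _ :=
  GRing.isMonoidMorphism.Build (gring R G) (gring R' G') gmap gmap_is_monoid_morphism.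

Lemma gaug_gmap x : gaug (gmap x) = f (gaug x).
Proof.
elim/gring_ind: x => [g c|a b IHa IHb]; last by rewrite !raddfD /= IHa IHb.
by rewrite gmap_gscal !gaugU.
Qed.

End GroupRingMap.

Record ideal (A : pzRingType) := Ideal {
  ideal_pred :> {pred A};
  ideal_subproof : [/\ 0 \in ideal_pred,
    {in ideal_pred &, forall x y, x - y \in ideal_pred},
    (forall a, {in ideal_pred, forall x, a * x \in ideal_pred}) &
    (forall a, {in ideal_pred, forall x, x * a \in ideal_pred})]
}.

Section RingQuotient.
Context (A : pzRingType) (J : ideal A).
Implicit Types a x y z : A.

Fact ideal_zmod_closed : zmod_closed (ideal_pred J).
Proof. by case: (ideal_subproof J). Qed.
HB.instance Definition _ :=
  GRing.isZmodClosed.Build A (ideal_pred J) ideal_zmod_closed.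

Lemma idealMl a x : x \in ideal_pred J -> a * x \in ideal_pred J.
Proof. by case: (ideal_subproof J) => _ _ + _; apply. Qed.
Lemma idealMr a x : x \in ideal_pred J -> x * a \in ideal_pred J.
Proof. by case: (ideal_subproof J) => _ _ _; apply. Qed.

Definition quo := Quotient.quot (ideal_pred J).
HB.instance Definition _ := GRing.Zmodule.on quo.

Definition qpi : A -> quo := \pi_(Quotient.quot (ideal_pred J))%qT.
Definition qrepr : quo -> A := repr.

Lemma qreprK : cancel qrepr qpi. Proof. exact: reprK. Qed.

Lemma qpi_eq x y : (qpi x = qpi y) <-> (x - y \in ideal_pred J).
Proof.
have E := Quotient.idealrBE (ideal_pred J) x y.
by split=> [xy|H]; [rewrite E; apply/eqP | apply/eqP; rewrite -E].
Qed.

Lemma qpi_is_zmod_morphism : zmod_morphism qpi.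
Proof. by move=> x y; rewrite /qpi raddfB. Qed.
HB.instance Definition _ :=
  GRing.isZmodMorphism.Build A quo qpi qpi_is_zmod_morphism.

Definition qmul (u v : quo) : quo := qpi (qrepr u * qrepr v).

Lemma qmul_pi x y : qmul (qpi x) (qpi y) = qpi (x * y).
Proof.
apply/qpi_eq.
have hx : qrepr (qpi x) - x \in ideal_pred J by apply/qpi_eq; rewrite qreprK.
have hy : qrepr (qpi y) - y \in ideal_pred J by apply/qpi_eq; rewrite qreprK.
rewrite -[_ * _](subrK (x * qrepr (qpi y))) -mulrBl -addrA -mulrBr.
by rewrite rpredD //; [exact: idealMr | exact: idealMl].
Qed.

Lemma quo_ind (P : quo -> Prop) : (forall x, P (qpi x)) -> forall u, P u.
Proof. by move=> H u; rewrite -(qreprK u). Qed.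

Lemma qmulA : associative qmul.
Proof.
by elim/quo_ind=> x; elim/quo_ind=> y; elim/quo_ind=> z; rewrite !qmul_pi mulrA.
Qed.
Lemma qmul1 : left_id (qpi 1) qmul.
Proof. by elim/quo_ind=> x; rewrite qmul_pi mul1r. Qed.
Lemma qmulr1 : right_id (qpi 1) qmul.
Proof. by elim/quo_ind=> x; rewrite qmul_pi mulr1. Qed.
Lemma qmulDl : left_distributive qmul +%R.
Proof.
elim/quo_ind=> x; elim/quo_ind=> y; elim/quo_ind=> z.
by rewrite !(qmul_pi, =^~ raddfD) mulrDl.
Qed.
Lemma qmulDr : right_distributive qmul +%R.
Proof.
elim/quo_ind=> x; elim/quo_ind=> y; elim/quo_ind=> z.
by rewrite !(qmul_pi, =^~ raddfD) mulrDr.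
Qed.

HB.instance Definition _ := GRing.Zmodule_isPzRing.Build quo
  qmulA qmul1 qmulr1 qmulDl qmulDr.

Lemma qpi_is_monoid_morphism : monoid_morphism qpi.
Proof. by split=> // x y; rewrite [RHS]qmul_pi. Qed.
HB.instance Definition _ :=
  GRing.isMonoidMorphism.Build A quo qpi qpi_is_monoid_morphism.

End RingQuotient.

(** The powers of a two-sided ideal: I^0 is the whole ring, and I^(n+1) consists
   of the finite sums of products x * y with x in I and y in I^n. *)
Section IdealPower.
Context (A : pzRingType) (I : ideal A).

Fixpoint in_pow (n : nat) (a : A) : Prop :=
  if n is n'.+1 then
    exists s : seq (A * A),
      (forall p, p \in s -> p.1 \in ideal_pred I /\ in_pow n' p.2) /\
      a = \sum_(p <- s) p.1 * p.2
  else True.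

Definition ipow_pred (n : nat) : {pred A} := fun a => `[< in_pow n a >].

Fact ipow_subproof n : [/\ 0 \in ipow_pred n,
    {in ipow_pred n &, forall x y, x - y \in ipow_pred n},
    (forall a, {in ipow_pred n, forall x, a * x \in ipow_pred n}) &
    (forall a, {in ipow_pred n, forall x, x * a \in ipow_pred n})].
Proof.
have E k x : (x \in ipow_pred k) = `[< in_pow k x >] by [].
elim: n => [|n [IH0 IHB IHl IHr]].
  have T x : x \in ipow_pred 0 by rewrite E; apply/asboolP.
  by split=> [|x y _ _|a x _|a x _]; exact: T.
split.
- by rewrite E; apply/asboolP; exists [::]; rewrite big_nil.
- move=> x y /asboolP[s [sP ->]] /asboolP[t [tP ->]]; rewrite E; apply/asboolP.
  exists (s ++ [seq (- p.1, p.2) | p <- t]); split; last first.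
    rewrite big_cat /= big_map -sumrN; congr (_ + _).
    by apply: eq_bigr => p _; rewrite mulNr.
  move=> p; rewrite mem_cat => /orP[/sP //|/mapP[q /tP[q1 q2] ->]] /=.
  by split=> //; rewrite rpredN.
- move=> a x /asboolP[s [sP ->]]; rewrite E; apply/asboolP.
  exists [seq (a * p.1, p.2) | p <- s]; split; last first.
    by rewrite big_map mulr_sumr; apply: eq_bigr => p _; rewrite mulrA.
  by move=> p /mapP[q /sP[q1 q2] ->] /=; split=> //; exact: idealMl.
- move=> a x /asboolP[s [sP ->]]; rewrite E; apply/asboolP.
  exists [seq (p.1, p.2 * a) | p <- s]; split; last first.
    by rewrite big_map mulr_suml; apply: eq_bigr => p _; rewrite mulrA.
  move=> p /mapP[q /sP[q1 q2] ->] /=; split=> //.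
  by have /(IHr a)/asboolP : q.2 \in ipow_pred n by apply/asboolP.
Qed.

Definition ipow (n : nat) : ideal A := Ideal (ipow_subproof n).

End IdealPower.

(** The I-adic completion of A: the inverse limit of the rings A / I^n. *)
Section Completion.
Context (A : pzRingType) (I : ideal A).

Definition coherent (x : forall n, quo (ipow I n)) : Prop :=
  forall n, exists a : A, x n = qpi (ipow I n) a /\
                          x n.+1 = qpi (ipow I n.+1) a.

Record completion := Completion {
  clim :> forall n, quo (ipow I n);
  clim_coherent : coherent clim
}.
HB.instance Definition _ := gen_eqMixin completion.
HB.instance Definition _ := gen_choiceMixin completion.

Lemma completionP (x y : completion) : (forall n, x n = y n) -> x = y.
Proof.
case: x y => [x xc] [y yc] /= xy.
have {}xy : x = y by apply: functional_extensionality_dep => n; exact: xy.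
by case: _ / xy in yc *; congr Completion; exact: Prop_irrelevance.
Qed.

Fact ctoc_subproof (a : A) : coherent (fun n => qpi (ipow I n) a).
Proof. by move=> n; exists a. Qed.
Definition ctoc (a : A) : completion := Completion (ctoc_subproof a).

Fact cadd_subproof (x y : completion) : coherent (fun n => x n + y n).
Proof.
move=> n; have [a [-> ->]] := clim_coherent x n.
have [b [-> ->]] := clim_coherent y n.
by exists (a + b); rewrite !rmorphD.
Qed.
Definition cadd x y := Completion (cadd_subproof x y).

Fact copp_subproof (x : completion) : coherent (fun n => - x n).
Proof.
move=> n; have [a [-> ->]] := clim_coherent x n.
by exists (- a); rewrite !rmorphN.
Qed.
Definition copp x := Completion (copp_subproof x).

Fact cmul_subproof (x y : completion) : coherent (fun n => x n * y n).
Proof.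
move=> n; have [a [-> ->]] := clim_coherent x n.
have [b [-> ->]] := clim_coherent y n.
by exists (a * b); rewrite !rmorphM.
Qed.
Definition cmul x y := Completion (cmul_subproof x y).

Fact caddA : associative cadd.
Proof. by move=> x y z; apply: completionP => n; exact: addrA. Qed.
Fact caddC : commutative cadd.
Proof. by move=> x y; apply: completionP => n; exact: addrC. Qed.
Fact cadd0 : left_id (ctoc 0) cadd.
Proof. by move=> x; apply: completionP => n /=; rewrite rmorph0 add0r. Qed.
Fact caddN : left_inverse (ctoc 0) copp cadd.
Proof. by move=> x; apply: completionP => n /=; rewrite rmorph0 addNr. Qed.
HB.instance Definition _ :=
  GRing.isZmodule.Build completion caddA caddC cadd0 caddN.

Fact cmulA : associative cmul.
Proof. by move=> x y z; apply: completionP => n; exact: mulrA. Qed.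
Fact cmul1 : left_id (ctoc 1) cmul.
Proof. by move=> x; apply: completionP => n /=; rewrite rmorph1 mul1r. Qed.
Fact cmulr1 : right_id (ctoc 1) cmul.
Proof. by move=> x; apply: completionP => n /=; rewrite rmorph1 mulr1. Qed.
Fact cmulDl : left_distributive cmul +%R.
Proof. by move=> x y z; apply: completionP => n; exact: mulrDl. Qed.
Fact cmulDr : right_distributive cmul +%R.
Proof. by move=> x y z; apply: completionP => n; exact: mulrDr. Qed.
HB.instance Definition _ := GRing.Zmodule_isPzRing.Build completion
  cmulA cmul1 cmulr1 cmulDl cmulDr.

Lemma ctoc_is_zmod_morphism : zmod_morphism ctoc.
Proof. by move=> x y; apply: completionP => n /=; rewrite rmorphB. Qed.
HB.instance Definition _ :=
  GRing.isZmodMorphism.Build A completion ctoc ctoc_is_zmod_morphism.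
Lemma ctoc_is_monoid_morphism : monoid_morphism ctoc.
Proof.
split; first exact: completionP.
by move=> x y; apply: completionP => n /=; rewrite rmorphM.
Qed.
HB.instance Definition _ :=
  GRing.isMonoidMorphism.Build A completion ctoc ctoc_is_monoid_morphism.

(** The kernel of the projection of the completion onto A / I^n. *)
Definition chat_pred (n : nat) : {pred completion} := fun x => x n == 0.

Fact chat_subproof n : [/\ 0 \in chat_pred n,
    {in chat_pred n &, forall x y, x - y \in chat_pred n},
    (forall a, {in chat_pred n, forall x, a * x \in chat_pred n}) &
    (forall a, {in chat_pred n, forall x, x * a \in chat_pred n})].
Proof.
have E x : (x \in chat_pred n) = (x n == 0) by [].
split; rewrite ?E /= ?rmorph0 //.
- by move=> x y /eqP x0 /eqP y0; rewrite E /= x0 y0 subr0.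
- by move=> a x /eqP x0; rewrite E /= x0 mulr0.
- by move=> a x /eqP x0; rewrite E /= x0 mul0r.
Qed.

Definition chat (n : nat) : ideal completion := Ideal (chat_subproof n).

End Completion.

(** The completed rational group algebra, for the augmentation ideal. *)
Section AugmentationCompletion.
Context (G : groupType).

Definition gaugi_pred : {pred gring rat G} := fun x => gaug x == 0.

Fact gaugi_subproof : [/\ 0 \in gaugi_pred,
    {in gaugi_pred &, forall x y, x - y \in gaugi_pred},
    (forall a, {in gaugi_pred, forall x, a * x \in gaugi_pred}) &
    (forall a, {in gaugi_pred, forall x, x * a \in gaugi_pred})].
Proof.
have E x : (x \in gaugi_pred) = (gaug x == 0) by [].
split; rewrite ?E ?rmorph0 //.
- by move=> x y /eqP x0 /eqP y0; rewrite E rmorphB /= x0 y0 subr0.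
- by move=> a x /eqP x0; rewrite E rmorphM /= x0 mulr0.
- by move=> a x /eqP x0; rewrite E rmorphM /= x0 mul0r.
Qed.

Definition gaugi : ideal (gring rat G) := Ideal gaugi_subproof.

Definition chg := completion gaugi.
HB.instance Definition _ := GRing.PzRing.on chg.

Definition chg_in (g : G) : chg := ctoc gaugi (gin rat g).

End AugmentationCompletion.

Section CompletionMap.
Context (G G' : groupType) (phi : {multiplicative G -> G'}).

Notation fmap := (gmap (idfun : {rmorphism rat -> rat}) phi).

Lemma gmap_pow n x : in_pow (gaugi G) n x -> in_pow (gaugi G') n (fmap x).
Proof.
elim: n x => // n IHn x [s [sP ->]].
exists [seq (fmap p.1, fmap p.2) | p <- s]; split.
  move=> p /mapP[q /sP[q1 q2] ->] /=; split; last exact: IHn.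
  rewrite [_ \in _](_ : _ = (gaug (fmap q.1) == 0)) // gaug_gmap /=.
  by move: q1; rewrite [_ \in _](_ : _ = (gaug q.1 == 0)).
by rewrite big_map rmorph_sum; apply: eq_bigr => p _; rewrite rmorphM.
Qed.

Lemma gmap_quo n x y : qpi (ipow (gaugi G) n) x = qpi (ipow (gaugi G) n) y ->
  qpi (ipow (gaugi G') n) (fmap x) = qpi (ipow (gaugi G') n) (fmap y).
Proof.
move=> /qpi_eq /asboolP H; apply/qpi_eq/asboolP.
by rewrite -rmorphB; exact: gmap_pow.
Qed.

Fact chg_map_subproof (x : chg G) :
  coherent (I := gaugi G') (fun n => qpi _ (fmap (qrepr (x n)))).
Proof.
move=> n; have [a [xn xn1]] := clim_coherent x n.
by exists (fmap a); split; apply: gmap_quo; rewrite qreprK.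
Qed.

(** The map between the completed group algebras induced by phi; on each
   quotient it is induced by the ring homomorphism Q[G] -> Q[G']. *)
Definition chg_map (x : chg G) : chg G' := Completion (chg_map_subproof x).

Lemma chg_map_in g : chg_map (chg_in g) = chg_in (phi g).
Proof.
apply: completionP => n /=; rewrite -[gin rat (phi g)](gmap_gscal idfun phi g 1).
by apply: gmap_quo; rewrite qreprK.
Qed.

Lemma chg_map_is_zmod_morphism : zmod_morphism chg_map.
Proof.
move=> x y; apply: completionP => n /=; rewrite -rmorphN -rmorphD -[in RHS]rmorphB.
by apply: gmap_quo; rewrite qreprK !rmorphB /= !qreprK.
Qed.
HB.instance Definition _ :=
  GRing.isZmodMorphism.Build (chg G) (chg G') chg_map chg_map_is_zmod_morphism.

Lemma chg_map_is_monoid_morphism : monoid_morphism chg_map.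
Proof.
split.
  apply: completionP => n /=; rewrite -(rmorph1 fmap).
  by apply: gmap_quo; rewrite qreprK.
move=> x y; apply: completionP => n /=; rewrite -rmorphM -[in RHS]rmorphM.
by apply: gmap_quo; rewrite qreprK !rmorphM /= !qreprK.
Qed.
HB.instance Definition _ :=
  GRing.isMonoidMorphism.Build (chg G) (chg G') chg_map chg_map_is_monoid_morphism.

End CompletionMap.

(** K_1 of a ring is represented by invertible square matrices: K_1(A) is the
   quotient of the stable general linear group by its subgroup of elementary
   matrices. *)
Section K1.
Context (A : pzRingType).

(** A square matrix M of size p, seen in size N >= p as diag(M, 1). The two
   dimensions are allowed to differ syntactically. *)
Definition stab (N p q : nat) (M : 'M[A]_(p, q)) : 'M[A]_N :=
  \matrix_(i < N, j < N)
    match insub (i : nat) : option 'I_p, insub (j : nat) : option 'I_q with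
    | Some i', Some j' => M i' j'
    | _, _ => (i == j)%:R
    end.

Inductive elementary (N : nat) : 'M[A]_N -> Prop :=
| elementary1 : elementary 1%:M
| elementaryM (i j : 'I_N) (a : A) (E : 'M[A]_N) : i != j -> elementary E ->
    elementary ((1%:M + a *: delta_mx i j) *m E).

Definition invertible_mx (p : nat) (M : 'M[A]_p) : Prop :=
  exists M' : 'M[A]_p, M *m M' = 1%:M /\ M' *m M = 1%:M.

(** M and M' are invertible and define the same element of K_1(A). *)
Definition K1_eq (p q : nat) (M : 'M[A]_p) (M' : 'M[A]_q) : Prop :=
  [/\ invertible_mx M, invertible_mx M' &
      exists (N : nat) (E : 'M[A]_N),
        [/\ (p <= N)%N, (q <= N)%N, elementary E &
            stab N M = E *m stab N M']].

End K1.

(** Torsion of a finite based chain complex of free right A-modules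
   C_k = A^(n k), written as column vectors; D k is the matrix of the boundary
   operator C_(k+1) -> C_k. *)
Section Torsion.
Context (A : pzRingType) (n : nat -> nat).
Context (D : forall k, 'M[A]_(n k, n k.+1)).

Definition acyclic : Prop :=
  (forall x : 'cV[A]_(n 0), exists y, x = D 0 *m y) /\
  (forall k (x : 'cV[A]_(n k.+1)),
     D k *m x = 0 <-> exists y, x = D k.+1 *m y).

Definition tors_width (r : nat -> nat) (k : nat) : nat :=
  if k is k'.+1 then (r k'.+1 + r k')%N else r 0.

(** The matrix [b_k b~_(k-1) / c_k] expressing, column by column, the basis
   obtained from b_k and from the lifts of b_(k-1) in terms of the given one. *)
Definition tors_mx (r : nat -> nat) (b : forall k, 'M[A]_(n k, r k))
    (b' : forall k, 'M[A]_(n k.+1, r k)) (k : nat) :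
    'M[A]_(n k, tors_width r k) :=
  match k with
  | 0 => b 0
  | k'.+1 => row_mx (b k'.+1) (b' k')
  end.

Record tors_data := TorsData {
  td_rank : nat -> nat;
  td_b : forall k, 'M[A]_(n k, td_rank k);
  td_lift : forall k, 'M[A]_(n k.+1, td_rank k);
  td_inv : forall k, 'M[A]_(tors_width td_rank k, n k);
  (* the columns of td_b k are a basis of the image of D k *)
  td_liftP : forall k, D k *m td_lift k = td_b k;
  td_span : forall k, exists Y, D k = td_b k *m Y;
  td_free : forall k (v : 'cV[A]_(td_rank k)), td_b k *m v = 0 -> v = 0;
  (* the concatenated families are bases *)
  td_width : forall k, tors_width td_rank k = n k;
  td_mxK : forall k, tors_mx td_b td_lift k *m td_inv k = 1%:M;
  td_invK : forall k, td_inv k *m tors_mx td_b td_lift k = 1%:M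
}.

Definition tors_size (d : nat) : nat := (\sum_(k < d) n k).+1.

(** The product of the matrices [b_k b~_(k-1) / c_k]^((-1)^(k+1)), for a complex
   that vanishes in degrees >= d. *)
Definition torsion (t : tors_data) (d : nat) : 'M[A]_(tors_size d) :=
  \big[mulmx/1%:M]_(k < d)
    if odd k then stab (tors_size d) (tors_mx (td_b t) (td_lift t) k)
    else stab (tors_size d) (td_inv t k).

(** The same class, multiplied by the sign (-1)^s. *)
Definition signed_torsion (t : tors_data) (d : nat) (s : bool) :
    'M[A]_(tors_size d) :=
  stab (tors_size d) ((((-1) ^+ s)%:M : 'M[A]_1)) *m torsion t d.

End Torsion.

Section ContinuityTools.
Context (R : realType).

Lemma continuous_glue (T X : topologicalType) (c : T -> R) (F G : T -> X) :
  continuous c -> continuous F -> continuous G ->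
  (forall p, c p = 0 -> F p = G p) ->
  continuous (fun p => if c p <= 0 then F p else G p).
Proof.
move=> cc cF cG FG p; set h := (h in continuous_at _ h).
have [cp|cp|cp] := ltgtP (c p) 0.
- have hF : \forall q \near p, F q = h q.
    have : \forall q \near p, c q < 0 by exact: (cvgr_lt _ (cc p)).
    by apply: filterS => q cq; rewrite /h (ltW cq).
  rewrite /continuous_at /h (ltW cp); apply: cvg_trans (cF p).
  exact: near_eq_cvg.
- have hG : \forall q \near p, G q = h q.
    have : \forall q \near p, 0 < c q by exact: (cvgr_gt _ (cc p)).
    by apply: filterS => q cq; rewrite /h leNgt cq.
  rewrite /continuous_at /h leNgt cp /=; apply: cvg_trans (cG p).
  exact: near_eq_cvg.
- rewrite /continuous_at {2}/h cp lexx => U UF.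
  have /cF V1 := UF; have := UF; rewrite FG // => /cG V2.
  rewrite /= /nbhs /=; near=> q; rewrite /h /=.
  by case: ifP => _; near: q.
Unshelve. all: by end_near. Qed.

Lemma continuous_pair (T X Y : topologicalType) (f : T -> X) (g : T -> Y) :
  continuous f -> continuous g -> continuous (fun t => (f t, g t)).
Proof. by move=> cf cg t; apply: cvg_pair; [exact: cf|exact: cg]. Qed.

Lemma continuous_fst (X Y : topologicalType) : continuous (@fst X Y).
Proof. by move=> p; exact: cvg_fst. Qed.

Lemma continuous_snd (X Y : topologicalType) : continuous (@snd X Y).
Proof. by move=> p; exact: cvg_snd. Qed.

Lemma continuous_compT (T X Y : topologicalType) (f : T -> X) (g : X -> Y) :
  continuous f -> continuous g -> continuous (fun t => g (f t)).
Proof. by move=> cf cg t; apply: continuous_comp; [exact: cf|exact: cg]. Qed.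

(** The retraction of the line onto [0, 1]. *)
Definition clamp (t : R) : R := Num.max 0 (Num.min 1 t).

Lemma clamp_id t : 0 <= t <= 1 -> clamp t = t.
Proof. by move=> /andP[t0 t1]; rewrite /clamp min_r // max_r. Qed.

Lemma clamp_01 t : 0 <= clamp t <= 1.
Proof. by rewrite /clamp le_max lexx /= ge_max ler01 ge_min lexx. Qed.

Section RealValued.
Context (T : topologicalType).
Implicit Types f g : T -> R.
Lemma ctD f g : continuous f -> continuous g -> continuous (fun t => f t + g t).
Proof. by move=> cf cg t; apply: cvgD; [exact: cf|exact: cg]. Qed.
Lemma ctN f : continuous f -> continuous (fun t => - f t).
Proof. by move=> cf t; apply: cvgN; exact: cf. Qed.
Lemma ctM f g : continuous f -> continuous g -> continuous (fun t => f t * g t).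
Proof. by move=> cf cg t; apply: cvgM; [exact: cf|exact: cg]. Qed.
Lemma ctC (a : R) : continuous (fun _ : T => a).
Proof. by move=> t; exact: cvg_cst. Qed.
Lemma ct_min f g : continuous f -> continuous g ->
  continuous (fun t => Num.min (f t) (g t)).
Proof. by move=> cf cg t; apply: continuous_min; [exact: cf|exact: cg]. Qed.
Lemma ct_max f g : continuous f -> continuous g ->
  continuous (fun t => Num.max (f t) (g t)).
Proof. by move=> cf cg t; apply: continuous_max; [exact: cf|exact: cg]. Qed.
Lemma ct_clamp f : continuous f -> continuous (fun t => clamp (f t)).
Proof. by move=> cf; apply: ct_max; [exact: ctC|apply: ct_min => //; exact: ctC]. Qed.
End RealValued.

Lemma ct_id (X : topologicalType) : continuous (fun t : X => t).
Proof. by move=> t; exact: cvg_id. Qed.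

End ContinuityTools.

Ltac ct :=
  lazymatch goal with
  | |- forall x, continuous_at x (fun t => @GRing.add _ _ _) =>
      apply: ctD; ct
  | |- forall x, continuous_at x (fun t => @GRing.opp _ _) =>
      apply: ctN; ct
  | |- forall x, continuous_at x (fun t => @GRing.mul _ _ _) =>
      apply: ctM; ct
  | |- forall x, continuous_at x (fun t => Num.min _ _) =>
      apply: ct_min; ct
  | |- forall x, continuous_at x (fun t => Num.max _ _) =>
      apply: ct_max; ct
  | |- forall x, continuous_at x (fun t => clamp _) => apply: ct_clamp; ct
  | |- forall x, continuous_at x (fun t => pair _ _) =>
      apply: continuous_pair; ct
  | |- forall x, continuous_at x (fun t => t) => exact: ct_id
  | |- forall x, continuous_at x (@GRing.add _ _) => apply: ctD; ct
  | |- forall x, continuous_at x (@GRing.mul _ _) => apply: ctM; ct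
  | |- forall x, continuous_at x (@GRing.opp _) => apply: ctN; ct
  | |- forall x, continuous_at x (Num.min _) => apply: ct_min; ct
  | |- forall x, continuous_at x (Num.max _) => apply: ct_max; ct
  | |- forall x, continuous_at x (@clamp _) => apply: ct_clamp; ct
  | |- forall x, continuous_at x id => exact: ct_id
  | |- forall x, continuous_at x (fun t => t.1) => exact: continuous_fst
  | |- forall x, continuous_at x (fun t => t.2) => exact: continuous_snd
  | |- forall x, continuous_at x fst => exact: continuous_fst
  | |- forall x, continuous_at x snd => exact: continuous_snd
  | |- _ => first [ assumption | exact: ctC ]
  end.

Section Paths.
Context (R : realType) (X : topologicalType).
Implicit Types (x y z : X) (f g h : R -> X).

(** Paths and homotopies are parametrised by R and R * R instead of [0, 1] and
   [0, 1]^2; only their values on [0, 1] and [0, 1]^2 are relevant, and any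
   continuous map on these extends continuously (precompose with clamp). *)
Definition is_path x y f := [/\ continuous f, f 0 = x & f 1 = y].

Definition homotopic x y f g := exists H : R * R -> X,
  [/\ continuous H,
      (forall t, 0 <= t <= 1 -> H (0, t) = f t /\ H (1, t) = g t) &
      (forall s, 0 <= s <= 1 -> H (s, 0) = x /\ H (s, 1) = y)].

Definition pcat f g : R -> X := fun t => if t <= 2^-1 then f (2 * t) else g (2 * t - 1).
Definition prev f : R -> X := fun t => f (1 - t).

Let zero01 : 0 <= (0 : R) <= 1. Proof. by rewrite lexx ler01. Qed.
Let one01 : 0 <= (1 : R) <= 1. Proof. by rewrite lexx ler01. Qed.

Lemma pcatE f g : pcat f g = fun t => if t - 2^-1 <= 0 then f (2 * t) else g (2 * t - 1).
Proof. by apply/funext => t; rewrite /pcat subr_le0. Qed.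

Lemma is_path_cat x y z f g : is_path x y f -> is_path y z g -> is_path x z (pcat f g).
Proof.
move=> [cf f0 f1] [cg g0 g1]; split.
- rewrite pcatE; apply: continuous_glue.
  + by ct.
  + by apply: (continuous_compT (f := fun t : R => 2 * t)) => //; ct.
  + by apply: (continuous_compT (f := fun t : R => 2 * t - 1)) => //; ct.
  + move=> p /eqP; rewrite subr_eq0 => /eqP ->.
    by rewrite mulfV ?pnatr_eq0 // subrr f1 g0.
- by rewrite /pcat invr_ge0 ler0n mulr0 f0.
- rewrite /pcat ifF; first by rewrite mulr1 (_ : 2 - 1 = 1) //; lra.
  by apply/negbTE; lra.
Qed.

Lemma is_path_rev x y f : is_path x y f -> is_path y x (prev f).
Proof.
move=> [cf f0 f1]; split; rewrite /prev ?subr0 ?subrr //.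
by apply: (continuous_compT (f := fun t : R => 1 - t)) => //; ct.
Qed.

Lemma is_path_cst x : is_path x x (fun=> x).
Proof. by split=> // t; exact: cvg_cst. Qed.

Lemma homotopic_reparam x y f (u v : R -> R) :
  is_path x y f -> continuous u -> continuous v ->
  u 0 = v 0 -> u 1 = v 1 -> f (u 0) = x -> f (u 1) = y ->
  homotopic x y (fun t => f (u t)) (fun t => f (v t)).
Proof.
move=> [cf _ _] cu cv u0 u1 fx fy.
exists (fun p => f ((1 - p.1) * u p.2 + p.1 * v p.2)); split.
- apply: (continuous_compT (f := fun p : R * R => (1 - p.1) * u p.2 + p.1 * v p.2)) => //.
  have cu2 : continuous (fun p : R * R => u p.2).
    by apply: (continuous_compT (f := snd)) => //; ct.
  have cv2 : continuous (fun p : R * R => v p.2).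
    by apply: (continuous_compT (f := snd)) => //; ct.
  by ct.
- by move=> t _ /=; rewrite subr0 subrr !mul0r !mul1r add0r addr0.
- move=> s _ /=; rewrite -u0 -u1 -fx -fy; split; congr f; ring.
Qed.

Lemma homotopic_refl x y f : is_path x y f -> homotopic x y f f.
Proof. by move=> [cf f0 f1]; apply: (homotopic_reparam (f := f) (u := id) (v := id)) => //; ct. Qed.

Lemma homotopic_sym x y f g : homotopic x y f g -> homotopic x y g f.
Proof.
move=> [H [cH Hfg Hxy]]; exists (fun p => H (1 - p.1, p.2)); split.
- by apply: (continuous_compT (f := fun p : R * R => (1 - p.1, p.2))) => //; ct.
- by move=> t /Hfg[H0 H1] /=; rewrite subr0 subrr.
- by move=> s s01 /=; apply: Hxy; lra.
Qed.

Lemma homotopic_trans x y f g h :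
  homotopic x y f g -> homotopic x y g h -> homotopic x y f h.
Proof.
move=> [H [cH Hfg Hxy]] [K [cK Kgh Kxy]].
exists (fun p => if p.1 - 2^-1 <= 0 then H (2 * p.1, clamp p.2)
                 else K (2 * p.1 - 1, clamp p.2)); split.
- apply: continuous_glue; first by ct.
  + by apply: (continuous_compT (f := fun p : R * R => (2 * p.1, clamp p.2))) => //; ct.
  + by apply: (continuous_compT (f := fun p : R * R => (2 * p.1 - 1, clamp p.2))) => //; ct.
  + move=> p /eqP; rewrite subr_eq0 => /eqP ->.
    rewrite mulfV ?pnatr_eq0 // subrr.
    by have [_ ->] := Hfg _ (clamp_01 p.2); have [-> _] := Kgh _ (clamp_01 p.2).
- move=> t t01 /=; rewrite clamp_id //.
  rewrite ifT ?mulr0; last by lra.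
  rewrite ifF; last by apply/negbTE; lra.
  rewrite (_ : 2 * 1 - 1 = 1); last by lra.
  by have [-> _] := Hfg _ t01; have [_ ->] := Kgh _ t01.
- move=> s s01 /=; rewrite !clamp_id //.
  by case: ifP => c; [apply: Hxy|apply: Kxy]; lra.
Qed.

Lemma homotopic_cat x y z f f' g g' : homotopic x y f f' -> homotopic y z g g' ->
  homotopic x z (pcat f g) (pcat f' g').
Proof.
move=> [H [cH Hff Hxy]] [K [cK Kgg Kyz]].
exists (fun p => if p.2 - 2^-1 <= 0 then H (clamp p.1, 2 * p.2)
                 else K (clamp p.1, 2 * p.2 - 1)); split.
- apply: continuous_glue; first by ct.
  + by apply: (continuous_compT (f := fun p : R * R => (clamp p.1, 2 * p.2))) => //; ct.
  + by apply: (continuous_compT (f := fun p : R * R => (clamp p.1, 2 * p.2 - 1))) => //; ct.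
  + move=> p /eqP; rewrite subr_eq0 => /eqP ->.
    rewrite mulfV ?pnatr_eq0 // subrr.
    by have [_ ->] := Hxy _ (clamp_01 p.1); have [-> _] := Kyz _ (clamp_01 p.1).
- move=> t t01 /=; rewrite !clamp_id // !pcatE.
  by case: ifP => c; [apply: Hff|apply: Kgg]; lra.
- move=> s s01 /=; rewrite !clamp_id //.
  rewrite ifT ?mulr0; last by lra.
  rewrite ifF; last by apply/negbTE; lra.
  rewrite (_ : 2 * 1 - 1 = 1); last by lra.
  by have [-> _] := Hxy _ s01; have [_ ->] := Kyz _ s01.
Qed.

Lemma homotopic_rev x y f g : homotopic x y f g -> homotopic y x (prev f) (prev g).
Proof.
move=> [H [cH Hfg Hxy]]; exists (fun p => H (p.1, 1 - p.2)); split.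
- by apply: (continuous_compT (f := fun p : R * R => (p.1, 1 - p.2))) => //; ct.
- by move=> t t01 /=; apply: Hfg; lra.
- by move=> s /Hxy[H0 H1] /=; rewrite subr0 subrr.
Qed.

Lemma homotopic_catA x y z w f g h :
  is_path x y f -> is_path y z g -> is_path z w h ->
  homotopic x w (pcat f (pcat g h)) (pcat (pcat f g) h).
Proof.
move=> pf pg ph; have pk := is_path_cat pf (is_path_cat pg ph).
pose u (t : R) := Num.min (Num.min (2 * t) (t + 4^-1)) (2^-1 * (t + 1)).
have -> : pcat (pcat f g) h = fun t => pcat f (pcat g h) (u t).
  apply/funext => t; rewrite /pcat /u.
  case: (leP t 2^-1) => t2; last first.
    rewrite [X in X <= _]min_r; last by rewrite le_min; lra.
    rewrite [Num.min _ (2^-1 * _)]min_r; last by rewrite le_min; lra.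
    rewrite ifF; last by apply/negbTE; lra.
    rewrite ifF; last by apply/negbTE; lra.
    by congr h; lra.
  case: (leP (2 * t) 2^-1) => t4.
    rewrite [Num.min (2 * t) _]min_l; last by lra.
    rewrite min_l; last by lra.
    by rewrite ifT //; congr f; lra.
  rewrite [Num.min (2 * t) _]min_r; last by lra.
  rewrite min_l; last by lra.
  rewrite ifF; last by apply/negbTE; lra.
  by rewrite ifT; [congr g|]; lra.
apply: (homotopic_reparam (u := id) (v := u) pk); rewrite ?/u; first by ct.
- by ct.
- by rewrite [Num.min (2 * 0) _]min_l ?min_l; lra.
- by rewrite [Num.min (2 * 1) _]min_r ?min_r; lra.
- by case: pk.
- by case: pk.
Qed.

Lemma homotopic_cst_cat x y f : is_path x y f -> homotopic x y f (pcat (fun=> x) f).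
Proof.
move=> pf; pose u (t : R) := Num.max 0 (2 * t - 1).
have -> : pcat (fun=> x) f = fun t => f (u t).
  apply/funext => t; rewrite /pcat /u; case: (leP t 2^-1) => t2.
    by rewrite max_l; [case: pf|lra].
  by rewrite max_r; [|lra].
apply: (homotopic_reparam (u := id) (v := u) pf); rewrite ?/u; first by ct.
- by ct.
- by rewrite max_l; lra.
- by rewrite max_r; lra.
- by case: pf.
- by case: pf.
Qed.

Lemma homotopic_cat_cst x y f : is_path x y f -> homotopic x y f (pcat f (fun=> y)).
Proof.
move=> pf; pose u (t : R) := Num.min 1 (2 * t).
have -> : pcat f (fun=> y) = fun t => f (u t).
  apply/funext => t; rewrite /pcat /u; case: (leP t 2^-1) => t2.
    by rewrite min_r; [|lra].
  by rewrite min_l; [case: pf|lra].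
apply: (homotopic_reparam (u := id) (v := u) pf); rewrite ?/u; first by ct.
- by ct.
- by rewrite min_r; lra.
- by rewrite min_l; lra.
- by case: pf.
- by case: pf.
Qed.

Lemma homotopic_cat_rev x y f : is_path x y f ->
  homotopic x x (fun=> x) (pcat f (prev f)).
Proof.
move=> pf; pose u (t : R) := Num.min (2 * t) (2 - 2 * t).
have -> : pcat f (prev f) = fun t => f (u t).
  apply/funext => t; rewrite /pcat /prev /u; case: (leP t 2^-1) => t2.
    by rewrite min_l; [|lra].
  by rewrite min_r; [congr f|]; lra.
have -> : (fun=> x) = fun t : R => f ((fun=> 0) t).
  by apply/funext => t; case: pf.
have pf0 : is_path (f 0) (f 1) f by case: pf.
have [cf fx fy] := pf.
exists (fun p => f (p.1 * u p.2)); split.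
- apply: (continuous_compT (f := fun p : R * R => p.1 * u p.2)) => //.
  by rewrite /u; ct.
- by move=> t _ /=; rewrite mul0r mul1r.
- move=> s _ /=; rewrite /u min_l; last by lra.
  rewrite min_r; last by lra.
  by split; rewrite -fx; congr f; lra.
Qed.

End Paths.

Section FundamentalGroup.
Context (R : realType) (X : topologicalType) (x0 : X).

Record loop := Loop { lfun :> R -> X; loopP : is_path x0 x0 lfun }.
HB.instance Definition _ := gen_eqMixin loop.
HB.instance Definition _ := gen_choiceMixin loop.

Lemma loop_eq (f g : loop) : lfun f = lfun g -> f = g.
Proof.
by case: f g => u uP [v vP] /= E; subst v; congr Loop; exact: Prop_irrelevance.
Qed.

Definition loop_rel (f g : loop) : bool := `[< homotopic x0 x0 f g >].

Fact loop_rel_equiv : equiv_class_of loop_rel.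
Proof.
split=> [f|f g|g f h].
- by apply/asboolP; apply: homotopic_refl; exact: loopP.
- by apply/asboolP/asboolP; exact: homotopic_sym.
- move=> /asboolP fg /asboolP gh; apply/asboolP; exact: homotopic_trans fg gh.
Qed.
Canonical loop_equiv := EquivRelPack loop_rel_equiv.

(** The fundamental group; the product f * g is f followed by g. *)
Definition pi1 := {eq_quot loop_rel}%qT.
HB.instance Definition _ := Choice.on pi1.

Definition pi1_pi (f : loop) : pi1 := (\pi_pi1 f)%qT.

Lemma pi1_eq (f g : loop) : pi1_pi f = pi1_pi g <-> homotopic x0 x0 f g.
Proof.
split=> [/eqP|H]; first by rewrite /pi1_pi eqmodE => /asboolP.
by apply/eqP; rewrite /pi1_pi eqmodE; exact/asboolP.
Qed.

Definition pi1_repr (a : pi1) : loop := repr a.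
Lemma pi1_reprK : cancel pi1_repr pi1_pi. Proof. exact: reprK. Qed.

Lemma pi1_ind (P : pi1 -> Prop) : (forall f, P (pi1_pi f)) -> forall a, P a.
Proof. by move=> H a; rewrite -(pi1_reprK a). Qed.

Definition lcat (f g : loop) : loop := Loop (is_path_cat (loopP f) (loopP g)).
Definition lrev (f : loop) : loop := Loop (is_path_rev (loopP f)).
Definition lcst : loop := Loop (is_path_cst R x0).

Definition pi1_mul (a b : pi1) : pi1 := pi1_pi (lcat (pi1_repr a) (pi1_repr b)).
Definition pi1_inv (a : pi1) : pi1 := pi1_pi (lrev (pi1_repr a)).

Lemma pi1_mulE f g : pi1_mul (pi1_pi f) (pi1_pi g) = pi1_pi (lcat f g).
Proof. by apply/pi1_eq; apply: homotopic_cat; apply/pi1_eq; rewrite pi1_reprK. Qed.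

Lemma pi1_invE f : pi1_inv (pi1_pi f) = pi1_pi (lrev f).
Proof. by apply/pi1_eq; apply: homotopic_rev; apply/pi1_eq; rewrite pi1_reprK. Qed.

Fact pi1_mulA : associative pi1_mul.
Proof.
elim/pi1_ind=> f; elim/pi1_ind=> g; elim/pi1_ind=> h; rewrite !pi1_mulE.
by apply/pi1_eq; exact: homotopic_catA (loopP f) (loopP g) (loopP h).
Qed.
Fact pi1_mul1 : left_id (pi1_pi lcst) pi1_mul.
Proof.
elim/pi1_ind=> f; rewrite pi1_mulE; apply/pi1_eq/homotopic_sym.
exact: homotopic_cst_cat (loopP f).
Qed.
Fact pi1_mulr1 : right_id (pi1_pi lcst) pi1_mul.
Proof.
elim/pi1_ind=> f; rewrite pi1_mulE; apply/pi1_eq/homotopic_sym.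
exact: homotopic_cat_cst (loopP f).
Qed.
Fact pi1_mulrV : right_inverse (pi1_pi lcst) pi1_inv pi1_mul.
Proof.
elim/pi1_ind=> f; rewrite pi1_invE pi1_mulE; apply/pi1_eq/homotopic_sym.
exact: homotopic_cat_rev (loopP f).
Qed.
Fact pi1_mulV : left_inverse (pi1_pi lcst) pi1_inv pi1_mul.
Proof.
elim/pi1_ind=> f; rewrite pi1_invE pi1_mulE; apply/pi1_eq/homotopic_sym.
have := homotopic_cat_rev (loopP (lrev f)); rewrite /= (_ : prev (prev f) = f) //.
by apply/funext => t; rewrite /prev; congr (f _); lra.
Qed.
HB.instance Definition _ := isGroup.Build pi1
  pi1_mulA pi1_mul1 pi1_mulr1 pi1_mulV pi1_mulrV.

(** The class of an arbitrary map, when it is a loop at x0. *)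
Definition pi1_class (f : R -> X) : pi1 :=
  if pselect (is_path x0 x0 f) is left fP then pi1_pi (Loop fP) else 1%g.

End FundamentalGroup.

Section FundamentalGroupMap.
Context (R : realType) (X Y : topologicalType) (x0 : X) (h : X -> Y).
Context (ch : continuous h).

Fact loop_map_subproof (f : loop R x0) : is_path (h x0) (h x0) (fun t => h (f t)).
Proof.
by have [cf f0 f1] := loopP f; split; rewrite ?f0 ?f1 //; exact: continuous_compT.
Qed.
Definition loop_map (f : loop R x0) : loop R (h x0) := Loop (loop_map_subproof f).

Definition pi1_map (a : pi1 R x0) : pi1 R (h x0) :=
  pi1_pi (loop_map (pi1_repr a)).

Lemma homotopic_map (f g : loop R x0) : homotopic x0 x0 f g ->
  homotopic (h x0) (h x0) (loop_map f) (loop_map g).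
Proof.
move=> [H [cH Hfg Hxy]]; exists (fun p => h (H p)); split.
- exact: continuous_compT.
- by move=> t /Hfg[-> ->].
- by move=> s /Hxy[-> ->].
Qed.

Lemma pi1_mapE f : pi1_map (pi1_pi f) = pi1_pi (loop_map f).
Proof. by apply/pi1_eq/homotopic_map/pi1_eq; rewrite pi1_reprK. Qed.

Fact pi1_mapM : {morph pi1_map : a b / (a * b)%g}.
Proof.
elim/pi1_ind=> f; elim/pi1_ind=> g.
rewrite (_ : (pi1_pi f * pi1_pi g)%g = pi1_pi (lcat f g)); last exact: pi1_mulE.
rewrite !pi1_mapE [RHS]pi1_mulE; congr pi1_pi; apply: loop_eq.
by apply/funext => t /=; rewrite /pcat; case: ifP.
Qed.
HB.instance Definition _ :=
  monoid.isMultiplicative.Build (pi1 R x0) (pi1 R (h x0)) pi1_map pi1_mapM.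

End FundamentalGroupMap.

(** The lower central series, G(1) = G. *)
Section LowerCentralSeries.
Context (G : groupType).

Definition is_subgroup (H : set G) : Prop :=
  [/\ H 1%g, forall a b, H a -> H b -> H (a * b)%g & forall a, H a -> H (a^-1)%g].

Definition subgroup_gen (S : set G) : set G :=
  [set a | forall H, is_subgroup H -> S `<=` H -> H a].

Fixpoint lcs (n : nat) : set G :=
  match n with
  | n'.+1 => if n' is 0 then setT
             else subgroup_gen [set c | exists a b, lcs n' b /\ c = commg a b]
  | 0 => setT
  end.

End LowerCentralSeries.

Section StandardSimplex.
Context (R : realType).

Definition simplex_set (n : nat) : set 'rV[R]_n.+1 :=
  [set v | (forall i, 0 <= v 0 i) /\ \sum_i v 0 i = 1].

Arguments simplex_set : clear implicits.

Definition stdsimplex (n : nat) := set_type (simplex_set n).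
HB.instance Definition _ n := Topological.on (stdsimplex n).

Definition bary (n : nat) (v : stdsimplex n) : 'rV[R]_n.+1 := \val v.

Lemma baryP n (v : stdsimplex n) : simplex_set n (bary v).
Proof. exact: set_mem (valP v). Qed.

Definition face_row (n : nat) (j : 'I_n.+2) (v : 'rV[R]_n.+1) : 'rV[R]_n.+2 :=
  \row_i if unlift j i is Some k then v 0 k else 0.

Fact face_subproof n (j : 'I_n.+2) (v : stdsimplex n) :
  face_row j (bary v) \in simplex_set n.+1.
Proof.
have [v0 v1] := baryP v; apply/mem_set; split.
  by move=> i; rewrite mxE; case: unlift.
rewrite (bigD1_ord j) //= mxE unlift_none add0r -[RHS]v1.
by apply: eq_bigr => i _; rewrite mxE liftK.
Qed.

Definition face (n : nat) (j : 'I_n.+2) (v : stdsimplex n) : stdsimplex n.+1 :=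
  exist (fun w => w \in simplex_set n.+1) _ (face_subproof j v).

Lemma continuous_row (T : topologicalType) n (f : T -> 'rV[R]_n) :
  (forall j, continuous (fun t => f t 0 j)) -> continuous f.
Proof.
move=> cf t A [P nP sPA].
have : \forall q \near t, forall j, P 0 j (f q 0 j).
  by apply: filter_forall => j; exact: (cf j t) (nP 0 j).
by apply: filterS => q H; apply: sPA => i j; rewrite ord1; exact: H.
Qed.

Lemma continuous_bary n j : continuous (fun v : stdsimplex n => bary v 0 j).
Proof.
move=> v; apply: (@continuous_comp _ _ _ (fun v : stdsimplex n => bary v)
  (fun w : 'rV[R]_n.+1 => w 0 j)); last exact: coord_continuous.
exact: initial_continuous.
Qed.

Lemma continuous_to_simplex (T : topologicalType) n (f : T -> stdsimplex n) :
  (forall j, continuous (fun t => bary (f t) 0 j)) -> continuous f.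
Proof.
move=> cf.
have cbf := continuous_row (f := fun t => bary (f t)) cf.
exact: (@continuous_comp_initial _ _ _ (@set_val _ (simplex_set n)) f cbf).
Qed.

Lemma continuous_face n (j : 'I_n.+2) : continuous (face j).
Proof.
apply: continuous_to_simplex => i; rewrite /face /bary /=.
case: (unliftP j i) => [k|] ij.
  rewrite (_ : (fun _ => _) = (fun v : stdsimplex n => bary v 0 k)).
    exact: continuous_bary.
  by apply/funext => v; rewrite mxE ij liftK.
rewrite (_ : (fun _ => _) = (fun _ : stdsimplex n => 0)); first exact: ctC.
by apply/funext => v; rewrite mxE ij unlift_none.
Qed.

End StandardSimplex.

Section SingularChains.
Context (R : realType).

Section Defs.
Context (X : topologicalType).

Record ssimplex (n : nat) := SSimplex {
  sfun :> stdsimplex R n -> X;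
  sfun_continuous : continuous sfun
}.
HB.instance Definition _ n := gen_eqMixin (ssimplex n).
HB.instance Definition _ n := gen_choiceMixin (ssimplex n).

Lemma ssimplex_eq n (s t : ssimplex n) : sfun s =1 sfun t -> s = t.
Proof.
case: s t => u uP [v vP] /= /funext E; subst v.
by congr SSimplex; exact: Prop_irrelevance.
Qed.

Definition schain (n : nat) := malg (ssimplex n) int.
HB.instance Definition _ n := GRing.Zmodule.on (schain n).

Definition schain1 (n : nat) (s : ssimplex n) : schain n := mkmalgU s 1.

Definition sface (n : nat) (j : 'I_n.+2) (s : ssimplex n.+1) : ssimplex n :=
  SSimplex (continuous_compT (continuous_face (j := j)) (@sfun_continuous _ s)).

Definition sbd_simplex (n : nat) (s : ssimplex n.+1) : schain n :=
  \sum_(j < n.+2) schain1 (sface j s) *~ (-1) ^+ j.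

Definition sbd_term (n : nat) (s : ssimplex n.+1) (c : int) : schain n :=
  sbd_simplex s *~ c.
Fact sbd_term_subproof n (s : ssimplex n.+1) : zmod_morphism (sbd_term s).
Proof. by move=> a b; rewrite /sbd_term mulrzBr. Qed.
HB.instance Definition _ n (s : ssimplex n.+1) :=
  GRing.isZmodMorphism.Build int (schain n) (sbd_term s) (sbd_term_subproof s).

Definition sbd (n : nat) : schain n.+1 -> schain n := mlin (@sbd_term n).
HB.instance Definition _ n := GRing.Additive.on (@sbd n).

Definition chain_in (A : set X) (n : nat) (c : schain n) : Prop :=
  forall s, s \in msupp c -> forall v, A (s v).

Definition zpred : {pred schain 1} := fun c => sbd c == 0.
Fact zpred_closed : zmod_closed zpred.
Proof.
have E c : (c \in zpred) = (sbd c == 0) by [].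
split=> [|c d]; rewrite !E ?raddf0 // => /eqP c0 /eqP d0.
by rewrite raddfB /= c0 d0 subr0.
Qed.
HB.instance Definition _ := GRing.isZmodClosed.Build (schain 1) zpred zpred_closed.

Record cycle := Cycle { cyc :> schain 1; cycP : cyc \in zpred }.
HB.instance Definition _ := [isSub for cyc].
HB.instance Definition _ := [Choice of cycle by <:].
HB.instance Definition _ := [SubChoice_isSubZmodule of cycle by <:].

Definition bpred : {pred cycle} :=
  fun c => `[< exists d : schain 2, cyc c = sbd d >].
Fact bpred_closed : zmod_closed bpred.
Proof.
split=> [|c d]; first by apply/asboolP; exists 0; rewrite raddf0.
move=> /asboolP[a ca] /asboolP[b db]; apply/asboolP; exists (a - b).
by rewrite raddfB /= -ca -db.
Qed.
HB.instance Definition _ := GRing.isZmodClosed.Build cycle bpred bpred_closed.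

Definition H1 := Quotient.quot bpred.
HB.instance Definition _ := GRing.Zmodule.on H1.

Definition H1_pi : cycle -> H1 := \pi_(Quotient.quot bpred)%qT.
Definition H1_repr : H1 -> cycle := repr.

Lemma H1_eq (c d : cycle) :
  H1_pi c = H1_pi d <-> exists e : schain 2, cyc c - cyc d = sbd e.
Proof.
have E := Quotient.idealrBE bpred c d; split=> [cd|H].
  have /asboolP[e He] : c - d \in bpred by rewrite E; apply/eqP.
  by exists e; rewrite -He; exact: esym (raddfB val c d).
have {}H : exists e : schain 2, cyc (c - d) = sbd e.
  by have [e He] := H; exists e; rewrite -He; exact: (raddfB val c d).
apply/eqP; rewrite /H1_pi -E; exact/asboolP.
Qed.

(** The homology class of a 1-chain, when it is a cycle. *)
Definition H1_class (c : schain 1) : H1 := H1_pi (insubd 0 c).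

End Defs.

Section Push.
Context (X Y : topologicalType) (f : X -> Y) (cf : continuous f).

Definition spush_simplex n (s : ssimplex X n) : ssimplex Y n :=
  SSimplex (continuous_compT (@sfun_continuous _ _ s) cf).

Definition spush_term n (s : ssimplex X n) (c : int) : schain Y n :=
  schain1 (spush_simplex s) *~ c.
Fact spush_term_subproof n (s : ssimplex X n) : zmod_morphism (spush_term s).
Proof. by move=> a b; rewrite /spush_term mulrzBr. Qed.
HB.instance Definition _ n (s : ssimplex X n) :=
  GRing.isZmodMorphism.Build int (schain Y n) (spush_term s)
    (spush_term_subproof s).

Definition spush n : schain X n -> schain Y n := mlin (@spush_term n).
HB.instance Definition _ n := GRing.Additive.on (@spush n).

Definition H1_map (a : H1 X) : H1 Y := H1_class (spush (cyc (H1_repr a))).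

End Push.
End SingularChains.

Section MultiplicativeGroup.
Context (V : zmodType).
Definition mgroup : Type := V.
HB.instance Definition _ := Choice.on mgroup.
HB.instance Definition _ := isGroup.Build mgroup
  (@addrA V) (@add0r V) (@addr0 V) (@addNr V) (@addrN V).
End MultiplicativeGroup.

Section Hurewicz.
Context (R : realType) (X : topologicalType).

Lemma bary_face_lift n (j : 'I_n.+2) (w : stdsimplex R n) k :
  bary (face j w) 0 (lift j k) = bary w 0 k.
Proof. by rewrite /face /bary /= mxE liftK. Qed.

Lemma bary_face_id n (j : 'I_n.+2) (w : stdsimplex R n) :
  bary (face j w) 0 j = 0.
Proof. by rewrite /face /bary /= mxE unlift_none. Qed.

Definition i31 : 'I_3 := Ordinal (isT : 1 < 3)%N.
Definition i32 : 'I_3 := Ordinal (isT : 2 < 3)%N.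

Fact spath_subproof (f : R -> X) : continuous f ->
  continuous (fun v : stdsimplex R 1 => f (bary v 0 ord_max)).
Proof.
by move=> cf; apply: (continuous_compT (f := fun v : stdsimplex R 1 => bary v 0 ord_max));
  [exact: continuous_bary|].
Qed.
Definition spath (f : R -> X) (cf : continuous f) : ssimplex R X 1 :=
  SSimplex (spath_subproof cf).

Lemma bary1 (w : stdsimplex R 1) : bary w 0 ord0 + bary w 0 ord_max = 1.
Proof.
have [_ <-] := baryP w; rewrite big_ord_recl big_ord1; congr (_ + bary w 0 _).
exact: val_inj.
Qed.

Lemma bary1_01 (w : stdsimplex R 1) : 0 <= bary w 0 ord_max <= 1.
Proof. by have [w0 _] := baryP w; have := bary1 w; have := w0 ord0; have := w0 ord_max; lra. Qed.

Lemma bary0 (w : stdsimplex R 0) : bary w 0 ord0 = 1.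
Proof. by have [_] := baryP w; rewrite big_ord1. Qed.

Lemma face20 (w : stdsimplex R 1) :
  (bary (face ord0 w) 0 i31 = bary w 0 ord0) *
  (bary (face ord0 w) 0 i32 = bary w 0 ord_max).
Proof.
rewrite (_ : i31 = lift ord0 ord0); last exact: val_inj.
rewrite (_ : i32 = lift ord0 ord_max); last exact: val_inj.
by rewrite !bary_face_lift.
Qed.

Lemma face21 (w : stdsimplex R 1) :
  (bary (face i31 w) 0 i31 = 0) *
  (bary (face i31 w) 0 i32 = bary w 0 ord_max).
Proof.
rewrite bary_face_id (_ : i32 = lift i31 ord_max); last exact: val_inj.
by rewrite !bary_face_lift.
Qed.

Lemma face22 (w : stdsimplex R 1) :
  (bary (face i32 w) 0 i31 = bary w 0 ord_max) *
  (bary (face i32 w) 0 i32 = 0).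
Proof.
rewrite bary_face_id (_ : i31 = lift i32 ord_max); last exact: val_inj.
by rewrite !bary_face_lift.
Qed.

Lemma sbd1 n (s : ssimplex R X n.+1) :
  sbd (schain1 s) = \sum_(j < n.+2) schain1 (sface j s) *~ (-1) ^+ j.
Proof. by rewrite /sbd mlinU /= /sbd_term mulr1z. Qed.

Lemma sbd2 (s : ssimplex R X 2) : sbd (schain1 s) =
  schain1 (sface ord0 s) - schain1 (sface i31 s) + schain1 (sface i32 s).
Proof.
rewrite sbd1 !big_ord_recl big_ord0 addr0 /= expr0 expr1 expr2 mulrNN mulr1.
rewrite mulrN1z !mulr1z addrA; congr (_ - schain1 (sface _ s) + schain1 (sface _ s)).
- exact: val_inj.
- exact: val_inj.
Qed.

Lemma spath_cycle x0 (f : loop R x0) (cf : continuous f) :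
  schain1 (spath cf) \in @zpred R X.
Proof.
have [_ f0 f1] := loopP f.
rewrite [_ \in _](_ : _ = (sbd (schain1 (spath cf)) == 0)) // sbd1.
rewrite !big_ord_recl big_ord0 addr0 /= expr0 expr1 mulrN1z mulr1z.
rewrite subr_eq0; apply/eqP; congr schain1; apply: ssimplex_eq => w /=.
rewrite (_ : ord_max = lift (ord0 : 'I_2) ord0); last exact: val_inj.
rewrite bary_face_lift bary0 f1.
by rewrite bary_face_id f0.
Qed.

Definition loop_cycle x0 (f : loop R x0) : cycle R X :=
  let: And3 cf _ _ := loopP f in Cycle (spath_cycle cf).

Lemma loop_cycleE x0 (f : loop R x0) (cf : continuous f) :
  cyc (loop_cycle f) = schain1 (spath cf).
Proof.
rewrite /loop_cycle; case: (loopP f) => cf' _ _ /=.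
by congr schain1; exact: ssimplex_eq.
Qed.

Lemma zmod_cancel (V : zmodType) (a b c d : V) :
  a - b = c - d + a - (b - d + c).
Proof.
rewrite [c - d + a]addrC (_ : b - d + c = c - d + b) ?addrKA //.
by rewrite -addrA addrC [- d + c]addrC.
Qed.

Lemma homotopic_hom x0 (f g : loop R x0) : homotopic x0 x0 f g ->
  H1_pi (loop_cycle f) = H1_pi (loop_cycle g).
Proof.
move=> [H [cH Hfg Hxy]]; have [cf _ _] := loopP f; have [cg _ _] := loopP g.
pose b j := fun v : stdsimplex R 2 => bary v 0 j.
have cb j : continuous (b j) by exact: continuous_bary.
have cA : continuous (fun v => H (b i32 v, b i31 v + b i32 v)).
  apply: (continuous_compT (f := fun v => (b i32 v, b i31 v + b i32 v))) => //.
  by apply: continuous_pair => //; apply: ctD.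
have cB : continuous (fun v => H (b i31 v + b i32 v, b i32 v)).
  apply: (continuous_compT (f := fun v => (b i31 v + b i32 v, b i32 v))) => //.
  by apply: continuous_pair => //; apply: ctD.
apply/H1_eq; exists (schain1 (SSimplex cA) - schain1 (SSimplex cB)).
rewrite (loop_cycleE cf) (loop_cycleE cg) raddfB /= !sbd2.
have c0 : sface ord0 (SSimplex cA) = sface i32 (SSimplex cB).
  apply: ssimplex_eq => w /=; rewrite /b !face20 !face22 bary1 addr0.
  by have [-> ->] := Hxy _ (bary1_01 w).
have c1 : sface i31 (SSimplex cA) = sface i31 (SSimplex cB).
  by apply: ssimplex_eq => w /=; rewrite /b !face21 add0r.
have cf2 : sface i32 (SSimplex cA) = spath cf.
  apply: ssimplex_eq => w /=; rewrite /b !face22 addr0.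
  by have [-> _] := Hfg _ (bary1_01 w).
have cg0 : sface ord0 (SSimplex cB) = spath cg.
  apply: ssimplex_eq => w /=; rewrite /b !face20 bary1.
  by have [_ ->] := Hfg _ (bary1_01 w).
rewrite c0 c1 cf2 cg0; exact: zmod_cancel.
Qed.

Lemma cat_hom x0 (f g : loop R x0) :
  H1_pi (loop_cycle (lcat f g)) = H1_pi (loop_cycle f) + H1_pi (loop_cycle g).
Proof.
have [cf f0 f1] := loopP f; have [cg g0 g1] := loopP g.
have [cfg _ _] := loopP (lcat f g).
have cC : continuous (fun v : stdsimplex R 2 => lcat f g (2^-1 * bary v 0 i31 + bary v 0 i32)).
  apply: (continuous_compT (f := fun v : stdsimplex R 2 => 2^-1 * bary v 0 i31 + bary v 0 i32)) => //.
  by apply: ctD; [apply: ctM; [exact: ctC|]|]; exact: continuous_bary.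
rewrite -raddfD; apply/esym/H1_eq; exists (schain1 (SSimplex cC)).
rewrite [cyc (_ + _)](raddfD val) /= (loop_cycleE cf) (loop_cycleE cg) (loop_cycleE cfg) sbd2.
rewrite [RHS]addrC addrA.
have -> : sface ord0 (SSimplex cC) = spath cg.
  apply: ssimplex_eq => w /=; rewrite !face20 /pcat; have := bary1 w; have := bary1_01 w.
  case: ifP => wle w01 w1; last by congr (g _); lra.
  have w0 : bary w 0 ord_max = 0 by lra.
  by rewrite w0 g0; apply: etrans f1; congr (f _); lra.
have -> : sface i32 (SSimplex cC) = spath cf.
  apply: ssimplex_eq => w /=; rewrite !face22 /pcat; have := bary1_01 w => w01.
  by rewrite ifT; [congr (f _)|]; lra.
have -> // : sface i31 (SSimplex cC) = spath cfg.
by apply: ssimplex_eq => w /=; rewrite !face21 mulr0 add0r.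
Qed.

Context (x0 : X).

Definition hurewicz (a : pi1 R x0) : mgroup (H1 R X) :=
  H1_pi (loop_cycle (pi1_repr a)).

Fact hurewiczM : {morph hurewicz : a b / (a * b)%g}.
Proof.
move=> a b; rewrite /hurewicz [RHS](_ : _ = H1_pi (loop_cycle (pi1_repr a)) +
  H1_pi (loop_cycle (pi1_repr b))) // -cat_hom.
by apply/homotopic_hom/pi1_eq; rewrite pi1_reprK.
Qed.
HB.instance Definition _ :=
  monoid.isMultiplicative.Build (pi1 R x0) (mgroup (H1 R X)) hurewicz hurewiczM.

End Hurewicz.

(** Topological manifolds of dimension n.+1, possibly with boundary. *)
Section Manifolds.
Context (R : realType).

Definition homeo_onto (X Y : topologicalType) (f : X -> Y) (B : set Y) : Prop :=
  [/\ continuous f, injective f, range f = B &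
      forall U : set X, open U -> exists V : set Y, open V /\ f @` U = V `&` B].

Lemma homeo_continuous (X Y : topologicalType) (f : X -> Y) (B : set Y) :
  homeo_onto f B -> continuous f.
Proof. by case. Qed.

Definition halfspace (n : nat) : set 'rV[R]_n.+1 := [set v | 0 <= v 0 ord0].

(** phi is a homeomorphism of the open neighbourhood U of x onto an open subset
   of the half-space. *)
Definition is_chart (n : nat) (X : topologicalType) (x : X) (U : set X)
    (phi : X -> 'rV[R]_n.+1) : Prop :=
  [/\ open U, U x,
      (forall y z, U y -> U z -> phi y = phi z -> y = z) &
      forall W, W `<=` U -> (open W <->
        exists V, open V /\ phi @` W = V `&` @halfspace n)].

Definition is_manifold (n : nat) (X : topologicalType) : Prop :=
  hausdorff_space X /\ forall x : X, exists U (phi : X -> 'rV[R]_n.+1), is_chart x U phi.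

Definition mboundary (n : nat) (X : topologicalType) : set X :=
  [set x | exists U (phi : X -> 'rV[R]_n.+1), is_chart x U phi /\ phi x 0 ord0 = 0].

(** The two chains define the same class in H_n(X, X \ x). *)
Definition homologous_at (n : nat) (X : topologicalType) (x : X)
    (c c' : schain R X n) : Prop :=
  exists d : schain R X n.+1, chain_in (~` [set x]) (c - c' - sbd d).

(** mu represents a class in H_n(X, bd X) which restricts to a generator of
   H_n(X, X \ x) for every interior point x, where n.+1 is the dimension of X:
   such a class is an orientation of a compact manifold X. *)
Definition fundamental_chain (n : nat) (X : topologicalType)
    (mu : schain R X n.+1) : Prop :=
  chain_in (mboundary n (X := X)) (sbd mu) /\
  forall x : X, ~ mboundary n x -> forall c : schain R X n.+1,
    chain_in (~` [set x]) (sbd c) -> exists m : int, homologous_at x c (mu *~ m).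

End Manifolds.
Arguments is_manifold : clear implicits.
Arguments mboundary : clear implicits.

(** Compact connected oriented surfaces of genus g with one boundary component;
   the genus is half the rank of the first homology group. *)
Section Surfaces.
Context (R : realType).

Record surface (g : nat) (S : topologicalType) := Surface {
  surf_compact : compact [set: S];
  surf_connected : connected [set: S];
  surf_manifold : is_manifold R 1 S;
  surf_bd_nonempty : mboundary R 1 S !=set0;
  surf_bd_connected : connected (mboundary R 1 S);
  surf_genus : exists e : 'I_(2 * g) -> H1 R S, forall x : H1 R S,
    exists! m : {ffun 'I_(2 * g) -> int}, x = \sum_i e i *~ m i;
  surf_or : schain R S 2;
  surf_orP : fundamental_chain surf_or
}.

Context (S : topologicalType).

(** Cap and cup products of a 2-chain with 1-cochains; sface i32 s and
   sface ord0 s are the front and back edges of the 2-simplex s. *)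
Definition cap (mu : schain R S 2) (f : ssimplex R S 1 -> int) : schain R S 1 :=
  \sum_(s <- msupp mu)
    schain1 (sface ord0 s) *~ (f (sface i32 s) * mcoeff s mu).

Definition cup_eval (f f' : ssimplex R S 1 -> int) (mu : schain R S 2) : int :=
  \sum_(s <- msupp mu) f (sface i32 s) * f' (sface ord0 s) * mcoeff s mu.

(** 1-cocycles of S relative to its boundary. *)
Definition rel_cocycle (f : ssimplex R S 1 -> int) : Prop :=
  (forall s : ssimplex R S 2,
     f (sface ord0 s) - f (sface i31 s) + f (sface i32 s) = 0) /\
  (forall s : ssimplex R S 1, (forall v, mboundary R 1 S (s v)) -> f s = 0).

Definition poincare_dual (mu : schain R S 2) (f : ssimplex R S 1 -> int)
    (x : H1 R S) : Prop :=
  [/\ rel_cocycle f, sbd (cap mu f) = 0 & H1_class (cap mu f) = x].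

(** omega is the intersection form of H_1(S; Z): x . y is the value on the
   fundamental class of the cup product of the Poincare duals of x and y. *)
Definition is_intersection_form (mu : schain R S 2)
    (omega : H1 R S -> H1 R S -> int) : Prop :=
  forall x y, exists f f', [/\ poincare_dual mu f x, poincare_dual mu f' y &
                               omega x y = cup_eval f f' mu].

End Surfaces.

Section HomologyCylinders.
Context (R : realType) (g : nat) (S : topologicalType) (sS : surface R g S).

Definition cyl_bd_set : set (S * R) :=
  [set p | (mboundary R 1 S p.1 /\ -1 <= p.2 <= 1) \/ (p.2 = 1 \/ p.2 = -1)].

Definition cyl_bd := set_type cyl_bd_set.
HB.instance Definition _ := Topological.on cyl_bd.

Fact cyl_pt_subproof (e : bool) (x : S) : (x, (-1) ^+ e) \in cyl_bd_set.
Proof. by apply/mem_set; right; case: e; rewrite /= ?expr1 ?expr0; [right|left]. Qed.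
(** The point (x, 1) or (x, -1). *)
Definition cyl_pt (e : bool) (x : S) : cyl_bd :=
  exist (fun p => p \in cyl_bd_set) _ (cyl_pt_subproof e x).

Lemma continuous_to_cyl (T : topologicalType) (f : T -> cyl_bd) :
  continuous (fun t => \val (f t)) -> continuous f.
Proof.
exact: (@continuous_comp_initial _ _ _ (@set_val _ cyl_bd_set) f).
Qed.

Lemma continuous_cyl_pt e : continuous (cyl_pt e).
Proof.
by apply: continuous_to_cyl => /=; apply: continuous_pair; [exact: ct_id|exact: ctC].
Qed.

Fact cyl_side_subproof (x : S) (bx : mboundary R 1 S x) (t : R) :
  (x, 2 * clamp t - 1) \in cyl_bd_set.
Proof. by apply/mem_set; left; split=> //=; have := clamp_01 t; lra. Qed.
(** The path t |-> (x, 2 t - 1) from (x, -1) to (x, 1), for x in bd S. *)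
Definition cyl_side (x : S) (bx : mboundary R 1 S x) (t : R) : cyl_bd :=
  exist (fun p => p \in cyl_bd_set) _ (cyl_side_subproof bx t).

(** The orientation of the boundary of S * [-1, 1] is the one which agrees with
   the orientation of S on S * {1}. *)
Definition cyl_orientation (nu : schain R cyl_bd 2) : Prop :=
  fundamental_chain nu /\
  forall x : S, ~ mboundary R 1 S x ->
    homologous_at (cyl_pt false x) nu
      (spush (continuous_cyl_pt (e := false)) (surf_or sS)).

Record homology_cobordism (M : topologicalType) := HomologyCobordism {
  hc_compact : compact [set: M];
  hc_connected : connected [set: M];
  hc_manifold : is_manifold R 2 M;
  hc_or : schain R M 3;
  hc_orP : fundamental_chain hc_or;
  hc_i : cyl_bd -> M;
  hc_iP : homeo_onto hc_i (mboundary R 2 M);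
  hc_i_or : exists nu : schain R cyl_bd 2, cyl_orientation nu /\
    exists d : schain R M 3, chain_in (mboundary R 2 M) d /\
      spush (homeo_continuous hc_iP) nu - sbd hc_or = sbd d;
  hc_H1 : forall e : bool, bijective (H1_map (R := R)
    (continuous_compT (continuous_cyl_pt (e := e)) (homeo_continuous hc_iP)))
}.

Context (M : topologicalType) (C : homology_cobordism M).

(** The inclusions of S: e = false for i_+ and e = true for i_-. *)
Definition hc_pm (e : bool) (x : S) : M := hc_i C (cyl_pt e x).

Lemma continuous_hc_pm e : continuous (hc_pm e).
Proof. exact: continuous_compT (continuous_cyl_pt (e := e)) (homeo_continuous (hc_iP C)). Qed.

Definition hc_H1_map (e : bool) : H1 R S -> H1 R M :=
  H1_map (continuous_hc_pm (e := e)).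

Definition is_homology_cylinder : Prop := hc_H1_map false =1 hc_H1_map true.

(** The map induced by i_- on fundamental groups. *)
Definition hc_pi_minus (x0 : S) : {multiplicative pi1 R x0 -> pi1 R (hc_pm true x0)} :=
  pi1_map (continuous_hc_pm (e := true)) (x0 := x0).

(** The map induced by i_+, the base points being joined by the side of the
   boundary of S * [-1, 1] over the base point x0 of bd S. *)
Definition hc_pi_plus (x0 : S) (bx0 : mboundary R 1 S x0) (a : pi1 R x0) :
    pi1 R (hc_pm true x0) :=
  let delta := fun t => hc_i C (cyl_side bx0 t) in
  pi1_class (hc_pm true x0)
    (pcat (pcat delta (fun t => hc_pm false (pi1_repr a t))) (prev delta)).

End HomologyCylinders.

(** Triangulations of a pair (M, B), with vertices in {0, ..., m-1}. *)
Section Triangulations.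
Context (R : realType).

Definition realization (m : nat) (K : {set {set 'I_m}}) : set 'rV[R]_m :=
  [set t | [/\ forall i, 0 <= t 0 i, \sum_i t 0 i = 1 &
               [set i | t 0 i != 0]%SET \in K]].

Definition is_complex (m : nat) (K : {set {set 'I_m}}) : Prop :=
  forall s, s \in K -> s != finset.set0 /\
    forall f : {set 'I_m}, f \subset s -> f != finset.set0 -> f \in K.

Record triangulation (M : topologicalType) (B : set M) := Triangulation {
  tr_m : nat;
  tr_K : {set {set 'I_tr_m}};
  tr_L : {set {set 'I_tr_m}};
  tr_KP : is_complex tr_K;
  tr_LP : is_complex tr_L;
  tr_LK : tr_L \subset tr_K;
  tr_h : 'rV[R]_tr_m -> M;
  tr_hP : homeo_onto (fun t : set_type (realization tr_K) => tr_h (\val t))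
                     [set: M];
  tr_hL : tr_h @` (realization tr_L) = B
}.

Arguments tr_h {M B} t.

Context (M : topologicalType) (B : set M) (T : triangulation B) (x0 : M).

(** Orders and orientations of the cells of M \ B, and lifts of these cells to
   the universal cover.  The universal cover of M is the set of homotopy classes
   of paths starting at x0, on which pi_1(M, x0) acts by composition; hence a
   lift of a simplex s is given by a path from x0 to a vertex of s. *)
Record cell_data := CellData {
  (* the ordered k-dimensional cells of M \ B *)
  cd_cells : nat -> seq {set 'I_(tr_m T)};
  cd_uniq : forall k, uniq (cd_cells k);
  cd_cellsP : forall k s,
    (s \in cd_cells k) = [&& s \in tr_K T, s \notin tr_L T & #|s| == k.+1];
  (* whether the orientation of s is opposite to the one given by the order of
     its vertices *)
  cd_sign : {set 'I_(tr_m T)} -> bool;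
  cd_vtx : {set 'I_(tr_m T)} -> 'I_(tr_m T);
  cd_path : {set 'I_(tr_m T)} -> R -> M;
  cd_lift : forall s, s \in tr_K T -> s \notin tr_L T ->
    cd_vtx s \in s /\
    is_path x0 (tr_h T (delta_mx 0 (cd_vtx s))) (cd_path s)
}.

Context (E : cell_data).

(** The straight path joining two vertices of a simplex. *)
Definition tr_edge (u v : 'I_(tr_m T)) : R -> M := fun t =>
  tr_h T ((1 - clamp t) *: delta_mx 0 u + clamp t *: delta_mx 0 v).

(** For a face f of s: the element c of pi_1(M, x0) such that t_c maps the lift
   of f to the corresponding face of the lift of s. *)
Definition deck (s f : {set 'I_(tr_m T)}) : pi1 R x0 :=
  pi1_class x0
    (pcat (pcat (cd_path E s) (tr_edge (cd_vtx E s) (cd_vtx E f)))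
          (prev (cd_path E f))).

Definition cd_rank (k : nat) : nat := size (cd_cells E k).

(** The boundary operator of C_*(M, B; A) in the basis given by the lifts.  The
   lift of f translated by t_c is (lift of f) . c^-1, so in the tensor product
   its coefficient is rho (c^-1).  For v in s, the face s \ v of s, with the
   orientations given by the order of the vertices, has the sign (-1)^j, where j
   is the number of vertices of s smaller than v. *)
Definition cell_bd (A : pzRingType) (rho : pi1 R x0 -> A) (k : nat) :
    'M[A]_(cd_rank k, cd_rank k.+1) :=
  \matrix_(i, j)
    let f := nth finset.set0 (cd_cells E k) i in
    let s := nth finset.set0 (cd_cells E k.+1) j in
    if (f \subset s)%SET then
      (-1) ^+ (cd_sign E s + cd_sign E f +
               \sum_(v in s :\: f) #|[set u in s | (u < v)%N]%SET|) *
      rho ((deck s f)^-1)%g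
    else 0.

(** The boundary operator of C_*(M, B; Q). *)
Definition cell_bd_rat := cell_bd (fun=> 1 : rat).

End Triangulations.

Section Alpha.
Context (R : realType) (g : nat) (S : topologicalType) (sS : surface R g S).
Context (M : topologicalType) (C : homology_cobordism sS M) (x0 : S).

Notation y0 := (hc_pm C true x0).
Notation HZ := (mgroup (H1 R S)).

Context (T : triangulation R (range (hc_pm C true))) (E : cell_data T y0).

(** tau^rho(M, bd_- M, E) for a ring map rho : Z pi_1(M) -> A, given on pi_1(M);
   t0 is used for the sign of the rational torsion.  There are no cells of
   dimension >= tr_m T. *)
Definition tors_sign (t0 : tors_data (cell_bd_rat E)) : bool :=
  \det (torsion t0 (tr_m T)) < 0.

Definition tau (A : pzRingType) (rho : pi1 R y0 -> A)
    (t0 : tors_data (cell_bd_rat E)) (t : tors_data (cell_bd E rho)) :=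
  signed_torsion t (tr_m T) (tors_sign t0).

(** The two coefficient maps; theta and j are the inverses of the isomorphisms
   induced by i_- on completed group algebras and on H_1. *)
Definition rho_tilde (theta : chg (pi1 R y0) -> chg (pi1 R x0)) (c : pi1 R y0) :
    chg (pi1 R x0) := theta (chg_in c).

Definition rho_Q (j : H1 R M -> H1 R S) (K : fieldType)
    (iota : gring int HZ -> K) (c : pi1 R y0) : K :=
  iota (gin int (j (hurewicz c) : HZ)).

(** An element sum_k h_k (x) [c_k, d_k] of H (x) L_2(H) is represented by the list
   of the (h_k, c_k, d_k), with h_k in H and c_k, d_k elements of pi whose
   classes are the corresponding elements of H. *)
Definition zpow (G : groupType) (a : G) (m : int) : G :=
  match m with Posz n => (a ^+ n)%g | Negz n => (a ^- n.+1)%g end.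

Context (bx0 : mboundary R 1 S x0) (omega : H1 R S -> H1 R S -> int).

Definition hcl (a : pi1 R x0) : H1 R S := hurewicz a.

Definition tensor3 := seq (H1 R S * pi1 R x0 * pi1 R x0).

(** l represents tau_1(M): for x in pi and u in pi with i_-(u) = i_+(x) modulo
   pi_1(M)(3), the class of u x^-1 in pi(2)/pi(3) is the product of the
   [c_k, d_k]^(h_k . x). *)
Definition represents_tau1 (l : tensor3) : Prop :=
  forall x u : pi1 R x0,
    (exists c, lcs 3 c /\ hc_pi_plus C bx0 x = (c * hc_pi_minus C x0 u)%g) ->
    exists c, lcs 3 c /\
      (u * x^-1)%g = (c * \prod_(p <- l) zpow (commg p.1.2 p.2) (omega p.1.1 (hcl x)))%g.

(** C (h (x) [c, d]) = (h . c) d - (h . d) c. *)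
Definition contraction (l : tensor3) : H1 R S :=
  \sum_(p <- l) (hcl p.2 *~ omega p.1.1 (hcl p.1.2) -
                 hcl p.1.2 *~ omega p.1.1 (hcl p.2)).

(** The class of x in K_1 of the quotient by I^2 is that of -1/2 C(tau_1(M)). *)
Definition preferred (p : nat) (x : 'M[chg (pi1 R x0)]_p) : Prop :=
  exists (l : tensor3) (c : pi1 R x0),
    [/\ represents_tau1 l, hcl c *+ 2 = - contraction l &
        K1_eq (map_mx (qpi (chat (gaugi (pi1 R x0)) 2)) x)
              ((qpi (chat (gaugi (pi1 R x0)) 2) (chg_in c))%:M : 'M[_]_1)].

(** K is the field of fractions of the group ring Z H. *)
Definition is_fraction_field (K : fieldType) (iota : gring int HZ -> K) : Prop :=
  injective iota /\
  forall z : K, exists a b, iota b != 0 /\ z = iota a / iota b.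

Definition chg_of_Z (a : gring int HZ) : chg HZ :=
  ctoc (gaugi HZ) (gmap (intr : {rmorphism int -> rat})
                        (idfun : {multiplicative HZ -> HZ}) a).

End Alpha.

(* Main.v *)
(* Let L be the group ring Z[H] and D the cellular chain complex of (M, d_- M)
   over L, with boundary operators coming from pi_1(M) -> H_1(M) = H.  Naturality
   of the Hurewicz map shows that both complexes of the statement become base
   changes of D: over the field of fractions of L for alpha, and, after applying
   Q[pi]^ -> Q[H]^, over Q[H]^ for alpha~.  The rational complex is acyclic, so
   its lifts of bases of the boundaries can be scaled to be integral and then
   lifted to L.  The determinants of the resulting base changes give p, q in L,
   the augmentation of q being non-zero, such that the torsion of every acyclic
   based base change f of D satisfies torsion * f q = f p.  The field of fractions
   yields alpha * q = +-p in L, and since q is invertible in Q[H]^, the torsion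
   over Q[H]^ has determinant alpha.  Finally Q[H]^ is local, so an invertible
   matrix over it is determined in K_1 by its determinant. *)
Require Import Defs.
From mathcomp Require Import all_boot all_order all_algebra.
From mathcomp Require Import all_classical all_reals all_analysis.
From mathcomp Require Import -(notations) monalg.
From mathcomp Require Import ring.
From HB Require Import structures.
Set Implicit Arguments.
Unset Strict Implicit.
Unset Printing Implicit Defensive.
Import GRing.Theory Num.Theory.
Local Open Scope classical_set_scope.
Local Open Scope ring_scope.

(** * Stabilization and torsion data *)

Section Stabilization.

(** Writing the larger size as [p + m] turns stabilization into block calculus; the later lemmas
    reach this form by [subnKC]. *)
Lemma stab_block (A : pzRingType) p m (M : 'M[A]_p) :
  stab (p + m) M = block_mx M 0 0 1%:M.
Proof.
have r (k : 'I_m) : insub (p + k)%N = None :> option 'I_p.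
  by rewrite insubN // -leqNgt leq_addr.
apply/matrixP => i j; case: (split_ordP i) => {}i ->; case: (split_ordP j) => {}j ->;
  rewrite mxE /= ?valK ?r ?(block_mxEul, block_mxEur, block_mxEdl, block_mxEdr) //.
- by rewrite mxE eq_lrshift.
- by rewrite mxE eq_rlshift.
- by rewrite mxE eq_rshift.
Qed.

(** The sizes are equal only propositionally, as in torsion data, where [td_width] identifies
    [tors_width] with the rank of the chain module. *)
Lemma stabM (A : pzRingType) p q r N (P : 'M[A]_(p, q)) (Q : 'M[A]_(q, r)) :
  q = p -> r = p -> (p <= N)%N -> stab N (P *m Q) = stab N P *m stab N Q.
Proof.
move=> qp rp; subst q r => /subnKC <-; rewrite !stab_block mulmx_block.
by rewrite !mul0mx !mulmx0 mul1mx !(addr0, add0r).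
Qed.

Lemma map_stab (A B : pzRingType) (f : {rmorphism A -> B}) p q N
    (M : 'M[A]_(p, q)) : map_mx f (stab N M) = stab N (map_mx f M).
Proof.
apply/matrixP => i j; rewrite !mxE.
case: insub => [i'|]; last by rewrite rmorph_nat.
by case: insub => [j'|]; rewrite ?mxE ?rmorph_nat.
Qed.

Lemma stab1 (A : pzRingType) p N : (p <= N)%N -> stab N (1%:M : 'M[A]_p) = 1%:M.
Proof. by move=> /subnKC <-; rewrite stab_block -scalar_mx_block. Qed.

Lemma det_stab (B : comPzRingType) p N (M : 'M[B]_p) :
  (p <= N)%N -> \det (stab N M) = \det M.
Proof. by move=> /subnKC <-; rewrite stab_block det_ublock det1 mulr1. Qed.

Lemma det_stab_scalar (B : comPzRingType) N (a : B) :
  \det (stab N.+1 (a%:M : 'M[B]_1)) = a.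
Proof. by rewrite det_stab // det_scalar1. Qed.

Lemma stab_id (A : pzRingType) p (M : 'M[A]_p) : stab p M = M.
Proof. by apply/matrixP => i j; rewrite mxE !valK. Qed.

End Stabilization.

(** * Base change of torsion data *)

Section TorsionDataMap.
Context (A B : pzRingType) (f : {rmorphism A -> B}) (n : nat -> nat).
Context (D : forall k, 'M[A]_(n k, n k.+1)).

Lemma map_tors_mx r (b : forall k, 'M[A]_(n k, r k))
    (b' : forall k, 'M[A]_(n k.+1, r k)) k :
  map_mx f (tors_mx b b' k) =
    tors_mx (fun k => map_mx f (b k)) (fun k => map_mx f (b' k)) k.
Proof. by case: k => //= k; rewrite map_row_mx. Qed.

(** The top rows of [td_inv t k] invert the columns of [td_b t k]. *)
Lemma td_b_left_inv (t : tors_data D) k : exists Z, Z *m td_b t k = 1%:M.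
Proof.
have := td_invK t k; case: k => [|k] /=; first by exists (td_inv t 0).
rewrite mul_mx_row -{1}[td_inv t k.+1]vsubmxK !mul_col_mx scalar_mx_block.
rewrite block_mxEh => /eq_row_mx[/eq_col_mx[E _] _].
by exists (usubmx (td_inv t k.+1)).
Qed.

Context (t : tors_data D) (D' : forall k, 'M[B]_(n k, n k.+1)).
Hypothesis DD' : forall k, D' k = map_mx f (D k).

Fact tors_map_liftP k : D' k *m map_mx f (td_lift t k) = map_mx f (td_b t k).
Proof. by rewrite DD' -map_mxM td_liftP. Qed.

Fact tors_map_span k : exists Y, D' k = map_mx f (td_b t k) *m Y.
Proof. by have [Y E] := td_span t k; exists (map_mx f Y); rewrite -map_mxM -E. Qed.

(** Injectivity alone could be lost under [f], but a left inverse is a matrix identity and is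
    preserved. *)
Fact tors_map_free k (v : 'cV[B]_(td_rank t k)) : map_mx f (td_b t k) *m v = 0 -> v = 0.
Proof.
have [Z Zb] := td_b_left_inv t k; move=> /(congr1 (mulmx (map_mx f Z))).
by rewrite mulmxA -map_mxM Zb map_mx1 mul1mx mulmx0.
Qed.

Fact tors_map_mxK k :
  tors_mx (fun k => map_mx f (td_b t k)) (fun k => map_mx f (td_lift t k)) k
    *m map_mx f (td_inv t k) = 1%:M.
Proof. by rewrite -map_tors_mx -map_mxM td_mxK map_mx1. Qed.

Fact tors_map_invK k : map_mx f (td_inv t k) *m
  tors_mx (fun k => map_mx f (td_b t k)) (fun k => map_mx f (td_lift t k)) k = 1%:M.
Proof. by rewrite -map_tors_mx -map_mxM td_invK map_mx1. Qed.

Definition tors_map : tors_data D' :=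
  TorsData tors_map_liftP tors_map_span tors_map_free (td_width t)
    tors_map_mxK tors_map_invK.

Lemma map_torsion d : map_mx f (torsion t d) = torsion tors_map d.
Proof.
rewrite /torsion (big_morph (map_mx f) (fun P Q => map_mxM f P Q) (map_mx1 f _)).
apply: eq_bigr => k _; case: odd; rewrite map_stab //.
by rewrite map_tors_mx.
Qed.

Lemma map_signed_torsion d s :
  map_mx f (signed_torsion t d s) = signed_torsion tors_map d s.
Proof.
by rewrite map_mxM map_torsion map_stab map_scalar_mx rmorph_sign.
Qed.

End TorsionDataMap.

Section RankUnique.

(** By [td_width] the ranks satisfy [r 0 = n 0] and [r k.+1 + r k = n k.+1], so they depend on [n]
    alone. Hence one family of lifts serves over all coefficient rings. *)
Lemma td_rank_unique (A B : pzRingType) n (D : forall k, 'M[A]_(n k, n k.+1))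
    (D' : forall k, 'M[B]_(n k, n k.+1)) (t : tors_data D) (t' : tors_data D') k :
  td_rank t k = td_rank t' k.
Proof.
elim: k => [|k IHk]; first by rewrite [LHS](td_width t 0) -(td_width t' 0).
have := td_width t' k.+1; rewrite -(td_width t k.+1) /= IHk.
by move/addIn.
Qed.

Lemma td_rank_eq0 (A : pzRingType) n (D : forall k, 'M[A]_(n k, n k.+1))
    (t : tors_data D) d : n d.+1 = 0%N -> td_rank t d = 0%N.
Proof.
by move=> nd; have := td_width t d.+1; rewrite nd /= => /eqP; rewrite addn_eq0 => /andP[_ /eqP].
Qed.

End RankUnique.

(** * Determinants attached to arbitrary families of lifts *)

Section LiftDeterminants.
Context (B : comPzRingType) (n r : nat -> nat).
Context (D : forall k, 'M[B]_(n k, n k.+1)) (L : forall k, 'M[B]_(n k.+1, r k)).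

(** The analogue of the base change matrix in [torsion], for chains [L] that need not come from
    bases; [stab] gives it a syntactically square shape. *)
Definition lift_det d (k : nat) : B :=
  \det (stab (tors_size n d) (tors_mx (fun k => D k *m L k) L k)).
(** In [torsion] the matrices of even degree occur inverted: [lift_even] is the denominator of the
    torsion and [lift_odd] its numerator. *)
Definition lift_even (d : nat) : B := \prod_(k < d | ~~ odd k) lift_det d k.
Definition lift_odd (d : nat) : B := \prod_(k < d | odd k) lift_det d k.

End LiftDeterminants.

Section LiftDeterminantsMap.
Context (A B : comPzRingType) (f : {rmorphism A -> B}) (n r : nat -> nat).
Context (D : forall k, 'M[A]_(n k, n k.+1)) (L : forall k, 'M[A]_(n k.+1, r k)).
Context (D' : forall k, 'M[B]_(n k, n k.+1)).
Hypothesis DD' : forall k, D' k = map_mx f (D k).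

Lemma map_lift_det d k :
  f (lift_det D L d k) = lift_det D' (fun k => map_mx f (L k)) d k.
Proof.
rewrite /lift_det -det_map_mx map_stab map_tors_mx; congr (\det (stab _ _)).
by case: k => [|k] /=; rewrite map_mxM DD'.
Qed.

Lemma map_lift_even d :
  f (lift_even D L d) = lift_even D' (fun k => map_mx f (L k)) d.
Proof. by rewrite rmorph_prod; apply: eq_bigr => k _; exact: map_lift_det. Qed.

Lemma map_lift_odd d :
  f (lift_odd D L d) = lift_odd D' (fun k => map_mx f (L k)) d.
Proof. by rewrite rmorph_prod; apply: eq_bigr => k _; exact: map_lift_det. Qed.

End LiftDeterminantsMap.

(* The chains [L] play the role of the lifts of bases of the boundaries: the
   base changes from the bases given by torsion data contribute the determinants
   [lift_coord_det], each of which occurs in two consecutive degrees and cancels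
   out of the alternating product. *)
Section TorsionComparison.
Context (B : comPzRingType) (n : nat -> nat).
Context (D : forall k, 'M[B]_(n k, n k.+1)).
Hypothesis DD : forall k, D k *m D k.+1 = 0.
Context (t : tors_data D).
Context (L : forall k, 'M[B]_(n k.+1, td_rank t k)).

Let N := tors_size n.

Lemma leq_tors_size d k : (k < d)%N -> (n k <= N d)%N.
Proof.
by move=> kd; rewrite leqW // (bigD1 (Ordinal kd)) //= leq_addr.
Qed.

Lemma boundary_coord k : exists Y, D k *m L k = td_b t k *m Y.
Proof. by have [Y E] := td_span t k; exists (Y *m L k); rewrite mulmxA -E. Qed.

(** In the basis made of [td_b t k.+1] and [td_lift t k], the boundary of [X] is [td_b t k] times
    the lower coordinates, which vanish by the left inverse of [td_b t k]. *)
Lemma cycle_coord k m (X : 'M[B]_(n k.+1, m)) : D k *m X = 0 ->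
  exists Z, X = td_b t k.+1 *m Z.
Proof.
move=> DX; have E : X = row_mx (td_b t k.+1) (td_lift t k) *m (td_inv t k.+1 *m X).
  by rewrite mulmxA (td_mxK t k.+1) mul1mx.
have Db : D k *m td_b t k.+1 = 0 by rewrite -td_liftP mulmxA DD mul0mx.
move: E; rewrite -[td_inv t k.+1 *m X]vsubmxK mul_row_col => E.
exists (usubmx (td_inv t k.+1 *m X)); rewrite {1}E.
suff -> : dsubmx (td_inv t k.+1 *m X) = 0 by rewrite mulmx0 addr0.
have [W Wb] := td_b_left_inv t k.
rewrite -[LHS]mul1mx -Wb -mulmxA.
move: DX; rewrite {1}E mulmxDr !mulmxA Db mul0mx add0r td_liftP.
by rewrite -mulmxA => ->; rewrite mulmx0.
Qed.

Definition lift_coord k := sval (cid (boundary_coord k)).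

Lemma lift_coordE k : D k *m L k = td_b t k *m lift_coord k.
Proof. exact: svalP (cid (boundary_coord k)). Qed.

(** The index is shifted: degree [k] involves the boundaries of degree [k - 1], and the value 1 at 0
    stands for the empty basis. *)
Definition lift_coord_det (k : nat) : B :=
  if k is k'.+1 then \det (lift_coord k') else 1.

Lemma lift_coord_scalar k (c : B) : L k = c *: td_lift t k -> lift_coord k = c%:M.
Proof.
move=> Lk; have [W Wb] := td_b_left_inv t k.
by rewrite -[LHS]mul1mx -Wb -mulmxA -lift_coordE Lk -scalemxAr td_liftP -scalemxAr
  Wb scalemx1.
Qed.

Let P k := tors_mx (td_b t) (td_lift t) k.
Local Notation Y := lift_coord.
Local Notation YE := lift_coordE.
Local Notation y := lift_coord_det.

(** The base change is block triangular with diagonal blocks [Y k] and [Y k.-1]: the column block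
    [L k.-1] agrees with [td_lift t k.-1 *m Y k.-1] up to a cycle. *)
Lemma lift_det_factor d k : (k < d)%N ->
  lift_det D L d k = \det (stab (N d) (P k)) * (y k.+1 * y k).
Proof.
move=> /leq_tors_size nd; have wk := td_width t k; rewrite /lift_det /P.
case: k nd wk => [|k] nd wk /=.
  rewrite YE stabM // det_mulmx mulr1 (@det_stab _ _ _ (Y 0)) //.
  by rewrite -[td_rank t 0]/(tors_width (td_rank t) 0) wk.
have [Z LE] : exists Z, L k = td_b t k.+1 *m Z + td_lift t k *m Y k.
  have [|Z ZE] := @cycle_coord k _ (L k - td_lift t k *m Y k).
    by rewrite mulmxBr mulmxA td_liftP YE subrr.
  by exists Z; rewrite -ZE subrK.
have -> : row_mx (D k.+1 *m L k.+1) (L k) =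
    row_mx (td_b t k.+1) (td_lift t k) *m block_mx (Y k.+1) Z 0 (Y k).
  by rewrite mul_row_block mulmx0 addr0 -YE -LE.
rewrite stabM // det_mulmx (@det_stab _ _ _ (block_mx _ _ _ _)) ?det_ublock //.
by rewrite -[X in (X <= _)%N]/(tors_width (td_rank t) k.+1) wk.
Qed.

Lemma det_stab_inv d k : (k < d)%N ->
  \det (stab (N d) (td_inv t k)) * \det (stab (N d) (P k)) = 1.
Proof.
move=> /leq_tors_size nd; rewrite -det_mulmx -stabM ?(td_width t) //.
by rewrite td_invK stab1 ?det1 // (td_width t).
Qed.

Lemma det_torsion_lift d : n d = 0%N ->
  \det (torsion t d) * lift_even D L d = lift_odd D L d.
Proof.
move=> nd; rewrite /torsion.
rewrite (big_morph (determinant (n := N d)) (fun P Q => det_mulmx P Q) (det1 _ _)).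
rewrite /lift_even /lift_odd.
pose Q k := if odd k then \det (stab (N d) (P k)) else \det (stab (N d) (td_inv t k)).
rewrite (eq_bigr (fun k : 'I_d => Q k)); last by move=> k _; rewrite /Q; case: odd.
(* For the products truncated at [e], only [y e] remains unmatched; it corrects the left side for
   even [e] and the right side for odd [e]. *)
have H e : (e <= d)%N ->
    (\prod_(k < e) Q k) * (\prod_(k < e | ~~ odd k) lift_det D L d k)
      * (if odd e then 1 else y e) =
    (\prod_(k < e | odd k) lift_det D L d k) * (if odd e then y e else 1).
  elim: e => [|e IHe] ed; first by rewrite !big_ord0 !mulr1.
  have F := lift_det_factor ed; have I := det_stab_inv ed.
  move: (y e.+1) F => z F.
  rewrite !(big_mkcond (fun k : 'I_e.+1 => _ (odd _))) /=.
  rewrite !(big_mkcond (fun k : 'I_e.+1 => odd _)) /= !big_ord_recr /=.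
  rewrite -!big_mkcond /=; move: (IHe (ltnW ed)); rewrite /Q.
  set q := \prod_(k < e) _; set ev := \prod_(k < e | _) _.
  set od := \prod_(k < e | _) _.
  case: (odd e); rewrite /= F ?mulr1 => IH.
    transitivity (q * ev * (\det (stab (N d) (P e)) * z)); first by ring.
    by rewrite IH; ring.
  transitivity (q * ev * y e * (\det (stab (N d) (td_inv t e)) * \det (stab (N d) (P e)))
     * z); first by ring.
  by rewrite I IH; ring.
(* At the top the unmatched factor is 1: by convention if [d] is 0, otherwise as the determinant of
   a matrix of size 0. *)
have := H d (leqnn d); suff yd : y d = 1 by rewrite yd if_same !mulr1.
case: (d) nd => // d' nd; rewrite /y.
have r0 := td_rank_eq0 t nd.
rewrite /y; move: (Y d'); rewrite r0 => A; exact: det_mx00.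
Qed.

End TorsionComparison.

(** Allows lifts indexed by the ranks of other torsion data, which agree only pointwise with those
    of [t]. *)
Lemma det_torsion_liftr (B : comPzRingType) n r (D : forall k, 'M[B]_(n k, n k.+1))
    (DD : forall k, D k *m D k.+1 = 0) (t : tors_data D)
    (L : forall k, 'M[B]_(n k.+1, r k)) d : td_rank t =1 r -> n d = 0%N ->
  \det (torsion t d) * lift_even D L d = lift_odd D L d.
Proof. by move=> /funext rE; subst r; exact: det_torsion_lift. Qed.

(** A single scalar for all entries keeps the cleared lifts proportional to the old ones, as
    [lift_coord_scalar] requires. *)
Lemma common_denominator m n (X : 'M[rat]_(m, n)) :
  exists c (Z : 'M[int]_(m, n)), c != 0 /\ map_mx intr Z = c%:~R *: X.
Proof.
have H (s : seq rat) : exists2 c : int, c != 0 &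
    forall x, x \in s -> exists z : int, z%:~R = c%:~R * x.
  elim: s => [|x s [c c0 cP]]; first by exists 1.
  exists (denq x * c); first by rewrite mulf_neq0 ?denq_neq0.
  move=> z; rewrite inE intrM => /predU1P[->|/cP[w w_]].
    by exists (numq x * c); rewrite intrM numqE; ring.
  by exists (denq x * w); rewrite intrM w_ mulrA.
have [c c0 cP] := H [seq X i.1 i.2 | i : 'I_m * 'I_n].
have {}cP i j : exists z : int, z%:~R = c%:~R * X i j.
  by apply: cP; apply/mapP; exists (i, j); rewrite ?mem_enum.
exists c, (\matrix_(i, j) sval (cid (cP i j))); split => //.
by apply/matrixP => i j; rewrite !mxE (svalP (cid (cP i j))).
Qed.

(* Clearing the denominators of rational lifts gives chains with coefficients in
   [A]; the ratio of the resulting determinants computes the torsion after every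
   base change which is acyclic. *)
Lemma universal_torsion (A : comPzRingType) (a : {rmorphism A -> int}) n
    (D : forall k, 'M[A]_(n k, n k.+1)) (D0 : forall k, 'M[rat]_(n k, n k.+1))
    (DD0 : forall k, D0 k = map_mx (intr \o a) (D k))
    (D0D0 : forall k, D0 k *m D0 k.+1 = 0) (t0 : tors_data D0) d :
  n d = 0%N -> exists p q : A, a q != 0 /\
    forall (B : comPzRingType) (f : {rmorphism A -> B})
      (D' : forall k, 'M[B]_(n k, n k.+1)) (DD' : forall k, D' k = map_mx f (D k))
      (D'D' : forall k, D' k *m D' k.+1 = 0) (t : tors_data D'),
      \det (torsion t d) * f q = f p.
Proof.
move=> nd; pose c k := sval (cid (common_denominator (td_lift t0 k))).
pose Z k := sval (cid (svalP (cid (common_denominator (td_lift t0 k))))).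
have cZ k : c k != 0 /\ map_mx intr (Z k) = (c k)%:~R *: td_lift t0 k.
  exact: svalP (cid (svalP (cid (common_denominator (td_lift t0 k))))).
(* Integers become constants of [A], which [a] sends back to themselves. *)
pose L k := map_mx (intr : {rmorphism int -> A}) (Z k).
exists (lift_odd D L d), (lift_even D L d); split; last first.
  move=> B f D' DD' D'D' t; rewrite (map_lift_even _ DD') (map_lift_odd _ DD').
  by apply: det_torsion_liftr => // k; exact: td_rank_unique.
rewrite -(intr_eq0 rat) -[_%:~R]/((intr \o a) _) (map_lift_even _ DD0).
have LE k : map_mx (intr \o a) (L k) = (c k)%:~R *: td_lift t0 k.
  by rewrite -(cZ k).2 -map_mx_comp; apply/matrixP => i j; rewrite !mxE /= rmorph_int intz.
(* Over the rationals each factor is the determinant of an invertible matrix times powers of the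
   non-zero denominators [c]. *)
apply/prodf_neq0 => k _; rewrite lift_det_factor //.
have yN i : @lift_coord_det _ _ D0 t0 (fun k => map_mx (intr \o a) (L k)) i != 0.
  case: i => [|i] /=; first by rewrite /= ?oner_eq0.
  rewrite (lift_coord_scalar (LE i)) det_scalar expf_neq0 // intr_eq0.
  by case: (cZ i).
rewrite !mulf_neq0 //; have := det_stab_inv t0 (ltn_ord k).
by apply: contra_eq_neq => ->; rewrite mulr0 eq_sym oner_eq0.
Qed.

(** * K_1 of a local ring *)

Section Elementary.
Context (A : pzRingType).

Lemma elementary_mulmx N (E F : 'M[A]_N) :
  elementary E -> elementary F -> elementary (E *m F).
Proof.
move=> + Fe; elim=> [|i j a G ij _ IH]; first by rewrite mul1mx.
by rewrite -mulmxA; exact: elementaryM.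
Qed.

Lemma elementary_transvection N (i j : 'I_N) (a : A) :
  i != j -> elementary (1%:M + a *: delta_mx i j).
Proof.
move=> ij; rewrite -[X in elementary X]mulmx1; apply: elementaryM => //.
exact: elementary1.
Qed.

Lemma mul_delta_delta0 N (i j k l : 'I_N) (a b : A) : j != k ->
  (a *: delta_mx i j) *m (b *: delta_mx k l) = 0.
Proof.
move=> jk; apply/matrixP => u v; rewrite !mxE big1 // => w _; rewrite !mxE.
have [->|wj] := eqVneq w j; last by rewrite andbF mulr0 mul0r.
by rewrite (negbTE jk) mulr0 mulr0.
Qed.

Lemma transvection_inv N (i j : 'I_N) (a : A) : i != j ->
  (1%:M + (- a) *: delta_mx i j) *m (1%:M + a *: delta_mx i j) = 1%:M.
Proof.
move=> ij; rewrite mulmxDl mul1mx mulmxDr mulmx1.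
by rewrite mul_delta_delta0 1?eq_sym // addr0 scaleNr -addrA subrr addr0.
Qed.

(** [F] is the product of the opposite transvections in reverse order. *)
Lemma elementary_cancel N (E M : 'M[A]_N) : elementary E ->
  exists2 F, elementary F & M = F *m (E *m M).
Proof.
move=> Ee; elim: Ee M => [|i j a G ij Ge IH] M.
  by exists 1%:M; [exact: elementary1 | rewrite !mul1mx].
have [F Fe FE] := IH M; exists (F *m (1%:M + (- a) *: delta_mx i j)).
  by apply: elementary_mulmx => //; exact: elementary_transvection.
by rewrite -!mulmxA [_ *m ((1%:M + _) *m _)]mulmxA transvection_inv // mul1mx.
Qed.

Lemma elementary_stab N m (E : 'M[A]_N) : elementary E ->
  elementary (block_mx E 0 0 (1%:M : 'M[A]_m)).
Proof.
elim=> [|i j a G ij _ IH]; first by rewrite -scalar_mx_block; exact: elementary1.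
have -> : block_mx ((1%:M + a *: delta_mx i j) *m G) 0 0 1%:M =
  (1%:M + a *: delta_mx (lshift m i) (lshift m j)) *m block_mx G 0 0 1%:M.
  rewrite (_ : 1%:M + _ = block_mx (1%:M + a *: delta_mx i j) 0 0 1%:M).
    by rewrite mulmx_block !mul0mx !mulmx0 mul1mx !addr0 add0r.
  rewrite [X in X + _]scalar_mx_block.
  apply/matrixP => u v; case: (split_ordP u) => {}u ->;
  case: (split_ordP v) => {}v ->;
  rewrite !(mxE, block_mxEul, block_mxEur, block_mxEdl, block_mxEdr);
  by rewrite ?(eq_lshift, eq_rshift, eq_lrshift, eq_rlshift) ?andbF ?mulr0 ?subr0 ?addr0.
by apply: elementaryM; rewrite // eq_lshift.
Qed.

(** Such block matrices multiply by adding their corners, so a decomposition of [X] into single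
    entries gives a product of transvections. *)
Lemma elementary_ublock N m (X : 'M[A]_(N, m)) :
  elementary (block_mx (1%:M : 'M[A]_N) X 0 (1%:M : 'M[A]_m)).
Proof.
rewrite [X]matrix_sum_delta.
pose P (Y : 'M[A]_(N, m)) := elementary (block_mx 1%:M Y 0 1%:M).
have P0 : P 0 by rewrite /P -scalar_mx_block; exact: elementary1.
have PD Y Z : P Y -> P Z -> P (Y + Z).
  move=> PY PZ; rewrite /P (_ : block_mx _ _ _ _ =
    block_mx 1%:M Z 0 1%:M *m block_mx 1%:M Y 0 1%:M); first exact: elementary_mulmx.
  by rewrite mulmx_block !mul1mx !mulmx1 !mul0mx ?mulmx0 !addr0 add0r.
elim/big_rec: _ => [//|i Y _ PY]; apply: (PD) => //.
elim/big_rec: _ => [//|j Z _ PZ]; apply: (PD) => //; rewrite /P.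
rewrite (_ : block_mx _ _ _ _ =
  1%:M + X i j *: delta_mx (lshift m i) (rshift N j)).
  by apply: elementary_transvection; rewrite eq_lrshift.
apply/matrixP => u v; rewrite scalar_mx_block; case: (split_ordP u) => {}u ->;
  case: (split_ordP v) => {}v ->;
  rewrite !(mxE, block_mxEul, block_mxEur, block_mxEdl, block_mxEdr);
  by rewrite ?(eq_lshift, eq_rshift, eq_lrshift, eq_rlshift) ?andbF /= ?mulr0 ?addr0 ?add0r.
Qed.

Lemma elementary_lblock N m (X : 'M[A]_(m, N)) :
  elementary (block_mx (1%:M : 'M[A]_N) 0 X (1%:M : 'M[A]_m)).
Proof.
rewrite [X]matrix_sum_delta.
pose P (Y : 'M[A]_(m, N)) := elementary (block_mx 1%:M 0 Y 1%:M).
have P0 : P 0 by rewrite /P -scalar_mx_block; exact: elementary1.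
have PD Y Z : P Y -> P Z -> P (Y + Z).
  move=> PY PZ; rewrite /P (_ : block_mx _ _ _ _ =
    block_mx 1%:M 0 Y 1%:M *m block_mx 1%:M 0 Z 1%:M); first exact: elementary_mulmx.
  by rewrite mulmx_block !mul1mx !mulmx1 !mul0mx ?mulmx0 !addr0 add0r.
elim/big_rec: _ => [//|i Y _ PY]; apply: (PD) => //.
elim/big_rec: _ => [//|j Z _ PZ]; apply: (PD) => //; rewrite /P.
rewrite (_ : block_mx _ _ _ _ =
  1%:M + X i j *: delta_mx (rshift N i) (lshift m j)).
  by apply: elementary_transvection; rewrite eq_rlshift.
apply/matrixP => u v; rewrite scalar_mx_block; case: (split_ordP u) => {}u ->;
  case: (split_ordP v) => {}v ->;
  rewrite !(mxE, block_mxEul, block_mxEur, block_mxEdl, block_mxEdr);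
  by rewrite ?(eq_lshift, eq_rshift, eq_lrshift, eq_rlshift) ?andbF /= ?mulr0 ?addr0 ?add0r.
Qed.

End Elementary.

Lemma stab_stab (A : pzRingType) p q N (M : 'M[A]_q) : (q <= p)%N -> (p <= N)%N ->
  stab N (stab p M) = stab N M.
Proof.
move=> qp pN; apply/matrixP => i j; rewrite !mxE.
have H (k : 'I_N) : (exists k' : 'I_p, insub (k : nat) = Some k' /\ k = k' :> nat) \/
    (insub (k : nat) = None :> option 'I_p /\ insub (k : nat) = None :> option 'I_q).
  have [kp|kp] := ltnP k p; first by left; exists (Ordinal kp); rewrite insubT.
  by right; rewrite !insubN // -leqNgt // (leq_trans qp).
case: (H i) => [[i' [-> ii']]|[-> ->]] //.
case: (H j) => [[j' [-> jj']]|[-> ->]]; last first.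
  by case: (insub (i : nat) : option 'I_q).
rewrite mxE -ii' -jj'; case: (insub (i : nat) : option 'I_q) => [?|];
by case: (insub (j : nat) : option 'I_q) => [?|]; rewrite // -!val_eqE /= ii' jj'.
Qed.

Lemma transvectionE (A : pzRingType) N m (M : 'M[A]_(N, m)) i j a k l :
  ((1%:M + a *: delta_mx i j) *m M) k l =
    M k l + (if k == i then a * M j l else 0).
Proof.
rewrite mulmxDl mul1mx -scalemxAl !mxE (bigD1 j) //= big1 => [|u uj]; last first.
  by rewrite mxE (negbTE uj) andbF mul0r.
by rewrite mxE eqxx andbT addr0; case: (k == i); rewrite ?mul1r // mul0r mulr0.
Qed.

Lemma det_transvection (B : comPzRingType) N (i j : 'I_N) (a : B) : i != j ->
  \det (1%:M + a *: delta_mx i j) = 1.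
Proof.
(* Transposition exchanges [i] and [j], so the matrix may be taken lower triangular. *)
move=> ij; wlog ji : i j ij / (j < i)%N => [H|].
  have [/H-> //|ji|/val_inj E] := ltngtP j i; last by rewrite E eqxx in ij.
  rewrite -det_tr linearD /= linearZ /= trmx1 trmx_delta; apply: H => //.
  by rewrite eq_sym.
rewrite det_trig; last first.
  apply/is_trig_mxP => k l kl; rewrite !mxE -val_eqE (ltn_eqF kl) add0r.
  case: eqVneq => [ki|]; rewrite ?mulr0 //=; case: eqVneq => [lj|]; rewrite ?mulr0 //.
  by rewrite ki lj in kl; have := ltn_trans kl ji; rewrite ltnn.
rewrite big1 // => k _; rewrite !mxE eqxx; case: eqVneq => [->|] /=; rewrite ?mulr0 ?addr0 //.
by rewrite (negbTE ij) mulr0 addr0.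
Qed.

Lemma det_elementary (B : comPzRingType) N (E : 'M[B]_N) :
  elementary E -> \det E = 1.
Proof.
elim=> [|i j a G ij _ IH]; first exact: det1.
by rewrite det_mulmx IH mulr1 det_transvection.
Qed.

(** * Row reduction over a local ring with maximal ideal the kernel of [eps] *)

Section LocalRing.
Context (B : comPzRingType) (F : fieldType) (eps : {rmorphism B -> F}).
Hypothesis epsU : forall x, eps x != 0 -> exists y, x * y = 1.

(** Column [l] contains a unit, since otherwise the expansion of the determinant along it would
    vanish under [eps]. A unit off the diagonal allows one transvection to correct the entry at
    [(l, l)]. *)
Lemma last_pivot n (M : 'M[B]_n.+2) (l : 'I_n.+2) : eps (\det M) != 0 ->
  exists2 E, elementary E & (E *m M) l l = 1.
Proof.
move=> dM; have S (P : 'M[B]_n.+2) i : i != l -> eps (P i l) != 0 ->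
    exists2 E, elementary E & (E *m P) l l = 1.
  move=> il /epsU[u iu]; exists (1%:M + ((1 - P l l) * u) *: delta_mx l i).
    by apply: elementary_transvection; rewrite eq_sym.
  by rewrite transvectionE eqxx -mulrA [u * _]mulrC iu mulr1 addrC subrK.
have /existsP[i iM] : [exists i, eps (M i l) != 0].
  apply: contra_neqT dM; rewrite negb_exists => /forallP H.
  rewrite (expand_det_col M l) rmorph_sum big1 // => i _.
  by rewrite rmorphM; have := H i; rewrite negbK => /eqP ->; rewrite mul0r.
have [il|il] := eqVneq i l; last exact: S iM.
(* If the unit found is the diagonal entry itself, it is first used to create a 1 in another row
   [k]; this is where size at least two matters. *)
subst i; have [k kl] : exists k, k != l.
  by have [->|l0] := eqVneq l ord0; [exists ord_max | exists ord0; rewrite eq_sym].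
have [u iu] := epsU iM; pose T := 1%:M + ((1 - M k l) * u) *: delta_mx k l.
have [|E Ee EM] := S (T *m M) k kl.
  rewrite transvectionE eqxx -mulrA [u * _]mulrC iu mulr1 addrC subrK.
  by rewrite rmorph1 oner_eq0.
exists (E *m T); last by rewrite -mulmxA.
by apply: elementary_mulmx => //; exact: elementary_transvection.
Qed.

(* Since the last column can be reduced to the last basis vector by row
   operations, no column operations are needed. *)
Lemma elementary_det_reduction N (M : 'M[B]_N) : eps (\det M) != 0 ->
  exists2 E, elementary E & M = E *m stab N ((\det M)%:M : 'M[B]_1).
Proof.
case: N M => [|N] M; first by exists 1%:M; [exact: elementary1 | apply/matrixP => -[]].
elim: N M => [|N IHN] M dM.
  exists 1%:M; first exact: elementary1.
  by rewrite mul1mx stab_id det_mx11 -mx11_scalar.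
move: M dM; rewrite -[N.+2]addn1 => M dM.
have [E1 E1e E1M] : exists2 E, elementary E &
    (E *m M) (rshift N.+1 ord0) (rshift N.+1 ord0) = 1.
  move: (rshift _ _) M dM; rewrite addn1 => l M dM; exact: last_pivot.
pose M1 := E1 *m M; pose X := - ursubmx M1.
(* [E2] clears the last column above the pivot, so that the determinant passes to the upper left
   block. *)
pose E2 := block_mx (1%:M : 'M[B]_N.+1) X 0 (1%:M : 'M[B]_1).
have E2e : elementary E2 := elementary_ublock _.
pose M' := ulsubmx M1 + X *m dlsubmx M1.
have dr : drsubmx M1 = 1%:M.
  by apply/matrixP => i j; rewrite !ord1 [RHS]mxE eqxx [LHS]mxE [LHS]mxE -E1M.
have E2M : E2 *m M1 = block_mx M' 0 (dlsubmx M1) 1%:M.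
  rewrite -[M1 in LHS]submxK mulmx_block !mul1mx !mul0mx !add0r dr mulmx1.
  by rewrite addrN.
have dM' : \det M' = \det M.
  have := congr1 determinant E2M; rewrite det_lblock det1 mulr1 => <-.
  by rewrite /M1 !det_mulmx (det_elementary E1e) (det_elementary E2e) !mul1r.
have [|E3 E3e ME3] := IHN M'; first by rewrite dM'.
have [u du] := epsU dM.
(* The remaining lower left row is written as [(dlsubmx M1 *m S') *m S], which moves it into an
   elementary factor to the left of the diagonal matrix. *)
pose S := stab N.+1 ((\det M)%:M : 'M[B]_1).
pose S' := stab N.+1 (u%:M : 'M[B]_1).
have SS' : S' *m S = 1%:M by rewrite -stabM // -scalar_mxM mulrC du stab1.
have [F1 F1e F1E] := elementary_cancel M E1e.
have [F2 F2e F2E] := elementary_cancel M1 E2e.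
exists (F1 *m (F2 *m (block_mx E3 0 0 1%:M *m block_mx 1%:M 0 (dlsubmx M1 *m S') 1%:M))).
  do 2!apply: elementary_mulmx => //.
  by apply: elementary_mulmx; [exact: elementary_stab|exact: elementary_lblock].
rewrite {1}F1E -/M1 {1}F2E E2M -!mulmxA; congr (_ *m (_ *m _)).
rewrite -(@stab_stab _ N.+1) // ?leq_addr // stab_block -/S.
rewrite [X in _ = _ *m X]mulmx_block -mulmxA SS'.
rewrite !mul1mx !mul0mx !mulmx0 mulmx1 !addr0 add0r mulmx_block.
by rewrite !mul1mx !mul0mx !mulmx0 !addr0 !add0r /S -dM' -ME3.
Qed.

End LocalRing.

(** * Completed group algebras *)

Section CommutativeCompletion.

Fact gring_mulC (R : comNzRingType) (V : zmodType) : commutative (@GRing.mul (gring R (mgroup V))).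
Proof.
move=> x y; elim/gring_ind: x => [g c|a b IHa IHb]; last first.
  by rewrite mulrDl mulrDr IHa IHb.
elim/gring_ind: y => [h d|a b IHa IHb]; last by rewrite mulrDl mulrDr IHa IHb.
rewrite [LHS]gmulU [RHS]gmulU mulrC; congr gscal; exact: addrC.
Qed.
HB.instance Definition _ (R : comNzRingType) (V : zmodType) :=
  GRing.PzRing_hasCommutativeMul.Build (gring R (mgroup V)) (@gring_mulC R V).

Fact quo_mulC (A : comPzRingType) (J : ideal A) : commutative (@GRing.mul (quo J)).
Proof.
by elim/quo_ind => x; elim/quo_ind => y; rewrite -!rmorphM mulrC.
Qed.

Fact completion_mulC (A : comPzRingType) (I : ideal A) :
  commutative (@GRing.mul (completion I)).
Proof. by move=> x y; apply: completionP => n; exact: quo_mulC. Qed.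

Fact chg_mulC (V : zmodType) : commutative (@GRing.mul (chg (mgroup V))).
Proof. exact: completion_mulC. Qed.
HB.instance Definition _ (V : zmodType) :=
  GRing.PzRing_hasCommutativeMul.Build (chg (mgroup V)) (@chg_mulC V).

End CommutativeCompletion.

(** * Units of adic completions *)

Section AdicUnits.
Context (A : pzRingType) (I : ideal A).

Lemma in_powS n a : in_pow I n.+1 a -> in_pow I n a.
Proof.
elim: n a => // n IHn a [s [sP ->]]; exists s; split => // p /sP[p1 p2].
by split=> //; exact: IHn.
Qed.

Lemma in_pow1 a : in_pow I 1 a <-> a \in ideal_pred I.
Proof.
split=> [[s [sP ->]]|aI].
  by rewrite big_seq; apply: rpred_sum => p /sP[p1 _]; exact: (Defs.idealMr (J := I) _ p1).
exists [:: (a, 1)]; rewrite big_seq1 mulr1; split=> // p.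
by rewrite inE => /eqP ->.
Qed.

Lemma in_powX n u : u \in ideal_pred I -> in_pow I n (u ^+ n).
Proof.
move=> uI; elim: n => // n IHn; exists [:: (u, u ^+ n)].
rewrite big_seq1 exprS; split=> // p; rewrite inE => /eqP -> //.
Qed.

Lemma qpi_ipowS n (a b : A) : qpi (ipow I n.+1) a = qpi (ipow I n.+1) b ->
  qpi (ipow I n) a = qpi (ipow I n) b.
Proof. by move=> /qpi_eq/asboolP H; apply/qpi_eq/asboolP; exact: in_powS. Qed.

(** Coherence lets a representative descend one level at a time. *)
Lemma clim1 (x : completion I) n a : x n.+1 = qpi (ipow I n.+1) a ->
  x 1 = qpi (ipow I 1) a.
Proof.
elim: n a => // n IHn a xa; apply: IHn.
have [c [-> xc]] := clim_coherent x n.+1.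
by apply: qpi_ipowS; rewrite -xc.
Qed.

Lemma clim_residue (x : completion I) n a c : x 1 = qpi (ipow I 1) a ->
  x n.+1 = qpi (ipow I n.+1) c -> c - a \in ideal_pred I.
Proof.
move=> xa /clim1 xc; apply/in_pow1/asboolP.
by apply/(qpi_eq (ipow I 1)); rewrite -xa -xc.
Qed.

Lemma qpi_pow0 n u : u \in ideal_pred I -> qpi (ipow I n) (u ^+ n) = 0.
Proof.
move=> uI; rewrite -(rmorph0 (qpi (ipow I n))); apply/qpi_eq/asboolP.
by rewrite subr0; exact: in_powX.
Qed.

End AdicUnits.

Section AdicInverse.
Context (A : comPzRingType) (I : ideal A) (x : completion I) (a b : A).
Hypotheses (xa : x 1 = qpi (ipow I 1) a) (ab : 1 - a * b \in ideal_pred I).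

(** Truncated geometric series for the inverse of [c], where [b] is an inverse of [c] modulo [I]. *)
Let series n (c : A) := b * \sum_(i < n) (1 - c * b) ^+ i.

Let residue n c : x n.+1 = qpi (ipow I n.+1) c -> 1 - c * b \in ideal_pred I.
Proof.
move=> /(clim_residue xa) ca.
have -> : 1 - c * b = (1 - a * b) - (c - a) * b by ring.
by rewrite rpredB // (Defs.idealMr (J := I) _ ca).
Qed.

Let inv n : quo (ipow I n) :=
  qpi _ b * \sum_(i < n) (1 - x n * qpi _ b) ^+ i.

Let invE n c : x n = qpi (ipow I n) c -> inv n = qpi (ipow I n) (series n c).
Proof.
move=> xc; rewrite /inv /series rmorphM rmorph_sum xc; congr (_ * _).
by apply: eq_bigr => i _; rewrite rmorphXn rmorphB rmorph1 rmorphM.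
Qed.

Let inv_coherent : coherent (I := I) inv.
Proof.
move=> n; have [c [xn xn1]] := clim_coherent x n.
exists (series n.+1 c); split; last exact: invE.
(* The series of consecutive levels differ by [b * (1 - c * b) ^+ n], which vanishes modulo the
   power [n] of [I]. *)
rewrite (invE xn) /series big_ord_recr /= mulrDr rmorphD.
by rewrite [X in _ = _ + X]rmorphM /= (qpi_pow0 _ (residue xn1)) mulr0 addr0.
Qed.

Lemma adic_unit : exists y : completion I, x * y = 1.
Proof.
exists (Completion inv_coherent); apply: completionP => -[|n].
  (* At level 0 the quotient is by the whole ring, hence zero. *)
  by rewrite -[LHS]qreprK; apply/qpi_eq/asboolP.
rewrite -[LHS]/(x n.+1 * inv n.+1) -[RHS]/(qpi (ipow I n.+1) 1).
have [c [_ xc]] := clim_coherent x n.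
rewrite (invE xc) xc -rmorphM /series mulrA.
(* This form makes the geometric sum telescope to [1 - (1 - c * b) ^+ n.+1]. *)
have {1}-> : c * b = - ((1 - c * b) - 1) by ring.
rewrite mulNr -subrX1 opprB rmorphB /= (qpi_pow0 _ (residue xc)); exact: subr0.
Qed.

End AdicInverse.

Section AugmentationOfCompletion.
Context (G : groupType).

(** The augmentation already factors through level 1; [chg_augE] gives independence of the
    representative. *)
Definition chg_aug (x : chg G) : rat := gaug (qrepr (clim x 1)).

Lemma gaug_in_pow1 (a : gring rat G) : in_pow (gaugi G) 1 a -> gaug a = 0.
Proof. by move=> /in_pow1/eqP. Qed.

Lemma chg_augE (x : chg G) a : clim x 1 = qpi (ipow (gaugi G) 1) a ->
  chg_aug x = gaug a.
Proof.
move=> xa; apply/eqP; rewrite -subr_eq0 -raddfB /=; apply/eqP/gaug_in_pow1/asboolP.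
by apply/(qpi_eq (ipow (gaugi G) 1)); rewrite qreprK.
Qed.

Fact chg_aug_is_zmod_morphism : zmod_morphism chg_aug.
Proof.
move=> x y; rewrite (@chg_augE _ (qrepr (clim x 1) - qrepr (clim y 1))) ?raddfB //.
by rewrite /= !qreprK.
Qed.
HB.instance Definition _ :=
  GRing.isZmodMorphism.Build (chg G) rat chg_aug chg_aug_is_zmod_morphism.

Fact chg_aug_is_monoid_morphism : monoid_morphism chg_aug.
Proof.
split; first by rewrite (@chg_augE _ 1) ?rmorph1.
move=> x y; rewrite (@chg_augE _ (qrepr (clim x 1) * qrepr (clim y 1))) ?rmorphM //.
by rewrite /= !qreprK.
Qed.
HB.instance Definition _ :=
  GRing.isMonoidMorphism.Build (chg G) rat chg_aug chg_aug_is_monoid_morphism.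

End AugmentationOfCompletion.

(** Modulo the augmentation ideal the inverse is the constant [(gaug a)^-1], which [adic_unit]
    lifts. So the completed algebra is local with residue field the rationals. *)
Lemma chg_unit (V : zmodType) (x : chg (mgroup V)) :
  chg_aug x != 0 -> exists y, x * y = 1.
Proof.
move=> x0; pose a := qrepr (clim x 1).
apply: (@adic_unit _ (gaugi (mgroup V)) x a (gscal 1%g (gaug a)^-1)).
  by rewrite qreprK.
rewrite [_ \in _](_ : _ = (gaug (1 - a * gscal 1%g (gaug a)^-1) == 0)) //.
by rewrite rmorphB rmorphM rmorph1 /= gaugU mulfV // subrr.
Qed.

(** * Naturality of the Hurewicz map *)

Section PushForward.
Context (R : realType) (X Y : topologicalType) (h : X -> Y) (ch : continuous h).

Lemma spush1 n (s : ssimplex R X n) :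
  spush ch (schain1 s) = schain1 (spush_simplex ch s).
Proof. by rewrite /spush mlinU /= /spush_term mulr1z. Qed.

Lemma sface_spush n (j : 'I_n.+2) (s : ssimplex R X n.+1) :
  sface j (spush_simplex ch s) = spush_simplex ch (sface j s).
Proof. exact: ssimplex_eq. Qed.

Lemma sbd_spush n (c : schain R X n.+1) : sbd (spush ch c) = spush ch (sbd c).
Proof.
apply: (malg_additive_ext (f := sbd (n := n) \o spush ch (n := n.+1))
  (f' := spush ch (n := n) \o sbd (n := n))) => s a /=.
rewrite (_ : mkmalgU s a = schain1 s *~ a); last first.
  by rewrite /schain1 -[a in LHS]intz raddfMz.
rewrite !raddfMz /= spush1 !sbd1 raddf_sum /=; congr (_ *~ _).
by apply: eq_bigr => j _; rewrite raddfMz /= spush1 sface_spush.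
Qed.

Fact spush_cycle (c : Defs.cycle R X) : spush ch (cyc c) \in @zpred R Y.
Proof.
rewrite [_ \in _](_ : _ = (sbd (spush ch (cyc c)) == 0)) //.
by rewrite sbd_spush (eqP (cycP _)) raddf0.
Qed.

(** The representative chosen in [H1_map] differs from [c] by a boundary, and pushing forward
    commutes with [sbd]. *)
Lemma H1_mapE (c : Defs.cycle R X) (c' : Defs.cycle R Y) : cyc c' = spush ch (cyc c) ->
  H1_map ch (H1_pi c) = H1_pi c'.
Proof.
move=> cc'; have [e He] : exists e, cyc (H1_repr (H1_pi c)) - cyc c = sbd e.
  by apply/H1_eq; exact: reprK.
rewrite /H1_map /H1_class; apply/H1_eq; exists (spush ch e).
by rewrite insubdK ?spush_cycle // cc' -raddfB /= He sbd_spush.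
Qed.

Lemma H1_ind (P : H1 R X -> Prop) : (forall c, P (H1_pi c)) -> forall a, P a.
Proof. by move=> H a; rewrite -(reprK a); exact: H. Qed.

Lemma H1_mapD : {morph H1_map (R := R) ch : a b / a + b}.
Proof.
elim/H1_ind => c; elim/H1_ind => d.
have E (x y : Defs.cycle R X) : H1_pi x + H1_pi y = H1_pi (x + y) by rewrite -raddfD.
rewrite E (H1_mapE (c' := Cycle (spush_cycle (c + d)))) //.
rewrite (H1_mapE (c' := Cycle (spush_cycle c))) //.
rewrite (H1_mapE (c' := Cycle (spush_cycle d))) //.
rewrite -[RHS]raddfD; congr H1_pi; apply: val_inj => /=.
by rewrite !raddfD.
Qed.

(** Already on chains, pushing forward the simplex of a loop gives the simplex of the composed
    loop. *)
Lemma hurewicz_natural x0 (a : pi1 R x0) :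
  hurewicz (pi1_map ch a) = H1_map ch (hurewicz a).
Proof.
elim/pi1_ind: a => f; rewrite pi1_mapE /hurewicz.
have E (Z : topologicalType) (z0 : Z) (l : loop R z0) :
    H1_pi (loop_cycle (pi1_repr (pi1_pi l))) = H1_pi (loop_cycle l).
  by apply/homotopic_hom/pi1_eq; rewrite pi1_reprK.
rewrite !E; apply/esym/H1_mapE.
have [cf _ _] := loopP f; have [chf _ _] := loopP (loop_map ch f).
rewrite (loop_cycleE cf) (loop_cycleE chf) spush1; congr schain1.
exact: ssimplex_eq.
Qed.

End PushForward.

(** * Functoriality of completed group algebras *)

Section CompletionFunctor.

Lemma clim_chg_map (G G' : groupType) (phi : {multiplicative G -> G'}) x n a :
  clim x n = qpi (ipow (gaugi G) n) a ->
  clim (chg_map phi x) n = qpi (ipow (gaugi G') n) (gmap idfun phi a).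
Proof. by move=> xa; apply: gmap_quo; rewrite qreprK. Qed.

(** The composite is a separate [chi], so that homomorphisms agreeing only pointwise can be
    compared. *)
Lemma chg_map_comp (G G' G'' : groupType) (phi : {multiplicative G -> G'})
    (psi : {multiplicative G' -> G''}) (chi : {multiplicative G -> G''}) :
  (forall a, psi (phi a) = chi a) ->
  forall x, chg_map psi (chg_map phi x) = chg_map chi x.
Proof.
move=> E x; apply: completionP => n.
have xn : clim x n = qpi _ (qrepr (clim x n)) by rewrite qreprK.
rewrite (clim_chg_map _ (clim_chg_map _ xn)) (clim_chg_map _ xn); congr qpi.
move: (qrepr _); elim/gring_ind => [g c|a b IHa IHb].
  by rewrite !gmap_gscal E.
by rewrite !raddfD /= IHa IHb.
Qed.

End CompletionFunctor.

(** * Cellular complexes and transfer of torsion between coefficient rings *)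

Lemma invertible_det (B : comPzRingType) n (M : 'M[B]_n) u :
  \det M * u = 1 -> invertible_mx M.
Proof.
move=> dM; exists (u *: \adj M).
by rewrite -scalemxAr -scalemxAl mul_mx_adj mul_adj_mx scale_scalar_mx mulrC dM.
Qed.

(** Each column of [D k.+1] is a boundary, hence a cycle. *)
Lemma acyclic_bd2 (A : pzRingType) n (D : forall k, 'M[A]_(n k, n k.+1)) k :
  acyclic D -> D k *m D k.+1 = 0.
Proof.
move=> [_ H]; apply/matrixP => i j.
have /H/(congr1 (fun M : 'cV_ _ => M i 0)) : exists y : 'cV[A]_(n k.+2),
    D k.+1 *m delta_mx j (0 : 'I_1) = D k.+1 *m y by exists (delta_mx j 0).
by rewrite mulmxA -colE !mxE.
Qed.

Section CellBoundary.
Context (R : realType) (M : topologicalType) (B : set M) (T : triangulation R B).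
Context (x0 : M) (E : cell_data T x0).

Lemma map_cell_bd (A A' : pzRingType) (f : {rmorphism A -> A'})
    (rho : pi1 R x0 -> A) (rho' : pi1 R x0 -> A') k :
  (forall c, f (rho c) = rho' c) -> cell_bd E rho' k = map_mx f (cell_bd E rho k).
Proof.
move=> fr; apply/matrixP => i j; rewrite !mxE /=.
by case: ifP => _; [rewrite rmorphM rmorph_sign fr | rewrite raddf0].
Qed.

(** A cell of dimension [tr_m T] would have [tr_m T] plus one vertices. *)
Lemma cd_rank_top : cd_rank E (tr_m T) = 0%N.
Proof.
rewrite /cd_rank; case Es: (cd_cells E (tr_m T)) => [//|s l].
have : s \in cd_cells E (tr_m T) by rewrite Es mem_head.
rewrite cd_cellsP => /and3P[_ _ /eqP ss].
by have := max_card (mem s); rewrite ss card_ord ltnn.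
Qed.

End CellBoundary.

Lemma det_signed_torsion (B : comPzRingType) n (D : forall k, 'M[B]_(n k, n k.+1))
    (t : tors_data D) d s :
  \det (signed_torsion t d s) = (-1) ^+ s * \det (torsion t d).
Proof. by rewrite det_mulmx det_stab_scalar. Qed.

Lemma det_torsion_transfer (A K B : comPzRingType) (a : {rmorphism A -> int})
    (iota : {rmorphism A -> K}) (phi : {rmorphism A -> B}) n
    (D : forall k, 'M[A]_(n k, n k.+1)) (D0 : forall k, 'M[rat]_(n k, n k.+1))
    (DK : forall k, 'M[K]_(n k, n k.+1)) (DB : forall k, 'M[B]_(n k, n k.+1))
    (t0 : tors_data D0) (tK : tors_data DK) (tB : tors_data DB) d s alpha :
  (forall k, D0 k = map_mx (intr \o a) (D k)) -> (forall k, D0 k *m D0 k.+1 = 0) ->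
  (forall k, DK k = map_mx iota (D k)) -> (forall k, DK k *m DK k.+1 = 0) ->
  (forall k, DB k = map_mx phi (D k)) -> (forall k, DB k *m DB k.+1 = 0) ->
  n d = 0%N -> injective iota ->
  (forall q, a q != 0 -> exists u, phi q * u = 1) ->
  \det (signed_torsion tK d s) = iota alpha ->
  \det (signed_torsion tB d s) = phi alpha.
Proof.
move=> D0E D0D0 DKE DKDK DBE DBDB nd iotaI phiU tKE.
have [p [q [q0 pqE]]] := universal_torsion D0E D0D0 t0 nd.
(* Injectivity of [iota] brings the relation down to [A], from where [phi] can carry it to [B]. *)
have eE : alpha * q = (-1) ^+ s * p.
  apply: iotaI; rewrite !rmorphM rmorph_sign -tKE det_signed_torsion -mulrA.
  by rewrite (pqE _ iota _ DKE DKDK).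
have [u qu] := phiU q q0.
rewrite -[LHS]mulr1 -qu det_signed_torsion mulrA -[X in X * u]mulrA.
by rewrite (pqE _ phi _ DBE DBDB) -(rmorph_sign phi s) -rmorphM -eE rmorphM -mulrA qu mulr1.
Qed.

Section IntegralGroupRing.
Context (V : zmodType).
Local Notation HV := (mgroup V).

Definition int_chg : {rmorphism gring int HV -> chg HV} :=
  ctoc (gaugi HV) \o gmap (intr : {rmorphism int -> rat}) (idfun : {multiplicative HV -> HV}).

Lemma chg_aug_int a : chg_aug (int_chg a) = (gaug a)%:~R.
Proof.
rewrite -(gaug_gmap (intr : {rmorphism int -> rat}) (idfun : {multiplicative HV -> HV})).
exact: chg_augE.
Qed.

Lemma int_chg_in h : int_chg (gin int h) = chg_in h.
Proof. by rewrite /int_chg /= gmap_gscal. Qed.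

End IntegralGroupRing.

(** The Hurewicz map of [X] factors as [j] after the Hurewicz map of [Y] after [pi1_map ch], and the
    last of these maps cancels [theta]. *)
Lemma chg_hurewicz_theta (R : realType) (X Y : topologicalType) (h : X -> Y)
    (ch : continuous h) (x0 : X) (theta : chg (pi1 R (h x0)) -> chg (pi1 R x0))
    (Ktheta : cancel theta (chg_map (pi1_map ch (x0 := x0))))
    (j : H1 R Y -> H1 R X) (jK : cancel (H1_map ch) j) (Kj : cancel j (H1_map ch))
    (c : pi1 R (h x0)) :
  chg_map (@hurewicz R X x0) (theta (chg_in c)) = chg_in (j (hurewicz c) : mgroup _).
Proof.
(* As the inverse of an additive map, [j] is additive. *)
have jM : {morph (j : mgroup (H1 R Y) -> mgroup (H1 R X)) : a b / (a * b)%g}.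
  move=> a b; apply: (can_inj jK); rewrite Kj [RHS]H1_mapD.
  by rewrite -{1}(Kj a) -{1}(Kj b).
pose jm : {multiplicative mgroup (H1 R Y) -> mgroup (H1 R X)} :=
  HB.pack (j : mgroup (H1 R Y) -> mgroup (H1 R X))
  (monoid.isMultiplicative.Build (mgroup (H1 R Y)) (mgroup (H1 R X)) j jM).
pose hi : {multiplicative pi1 R x0 -> mgroup (H1 R Y)} :=
  @hurewicz R Y (h x0) \o pi1_map ch (x0 := x0).
rewrite -(@chg_map_comp _ _ _ hi jm); last first.
  by move=> a; rewrite /= hurewicz_natural jK.
rewrite -(@chg_map_comp _ _ _ (pi1_map ch (x0 := x0)) (@hurewicz R Y (h x0)) hi) //.
by rewrite Ktheta !chg_map_in.
Qed.

(** * Commutativity of the square *)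

Theorem proposition3p3 (R : realType) (g : nat)
    (S : topologicalType) (sS : surface R g S)
    (omega : H1 R S -> H1 R S -> int)
    (omegaP : is_intersection_form (surf_or sS) omega)
    (x0 : S) (bx0 : mboundary R 1 S x0)
    (M : topologicalType) (C : homology_cobordism sS M)
    (CP : is_homology_cylinder C)
    (theta : chg (pi1 R (hc_pm C true x0)) -> chg (pi1 R x0))
    (thetaK : cancel (chg_map (hc_pi_minus C x0)) theta)
    (Ktheta : cancel theta (chg_map (hc_pi_minus C x0)))
    (j : H1 R M -> H1 R S)
    (jK : cancel (hc_H1_map C true) j) (Kj : cancel j (hc_H1_map C true))
    (K : fieldType) (iota : {rmorphism gring int (mgroup (H1 R S)) -> K})
    (iotaP : is_fraction_field iota)
    (T : triangulation R (range (hc_pm C true)))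
    (E : cell_data T (hc_pm C true x0))
    (ac0 : acyclic (cell_bd_rat E))
    (ac1 : acyclic (cell_bd E (rho_tilde theta)))
    (ac2 : acyclic (cell_bd E (rho_Q j iota)))
    (t0 : tors_data (cell_bd_rat E))
    (t1 : tors_data (cell_bd E (rho_tilde theta)))
    (t2 : tors_data (cell_bd E (rho_Q j iota)))
    (EP : preferred C bx0 omega (tau t0 t1))
    (alpha : gring int (mgroup (H1 R S)))
    (alpha1 : gaug alpha = 1)
    (alphaP : \det (tau t0 t2) = iota alpha) :
  K1_eq (map_mx (chg_map (@hurewicz R S x0)) (tau t0 t1))
        ((chg_of_Z alpha)%:M : 'M[_]_1).
Proof.
set f := chg_map _; set t := map_mx f _.
have -> : chg_of_Z alpha = int_chg (H1 R S) alpha by [].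
set phi := int_chg (H1 R S); pose HZ := mgroup (H1 R S).
(* The integral group ring of [H] is the common source of the rational, fraction field and completed
   coefficients. *)
pose rho (c : pi1 R (hc_pm C true x0)) : gring int HZ := gin int (j (hurewicz c) : HZ).
pose rhoA c : chg HZ := phi (rho c).
(* The augmentation sends every group element to 1. *)
have D0E k : cell_bd_rat E k = map_mx (intr \o @gaug int HZ) (cell_bd E rho k).
  by apply: map_cell_bd => c; rewrite /= gaugU.
have D2E k : cell_bd E (rho_Q j iota) k = map_mx iota (cell_bd E rho k).
  exact: map_cell_bd.
have DAE k : cell_bd E rhoA k = map_mx phi (cell_bd E rho k).
  exact: map_cell_bd.
have D1E k : cell_bd E rhoA k = map_mx f (cell_bd E (rho_tilde theta) k).
  apply: map_cell_bd => c; rewrite /rhoA /rho /phi int_chg_in.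
  exact: (chg_hurewicz_theta Ktheta jK Kj).
have tE : t = signed_torsion (tors_map t1 D1E) (tr_m T) (tors_sign t0).
  exact: map_signed_torsion.
have dt : \det t = phi alpha.
  rewrite tE; apply: (@det_torsion_transfer (gring int HZ) K (chg HZ) (@gaug int HZ) iota phi
     _ _ _ _ _ t0 t2 (tors_map t1 D1E) (tr_m T) (tors_sign t0) alpha D0E _ D2E _ DAE).
  - by move=> k; exact: acyclic_bd2.
  - by move=> k; exact: acyclic_bd2.
  - by move=> k; rewrite !D1E -map_mxM acyclic_bd2 // map_mx0.
  - exact: cd_rank_top.
  - exact: (proj1 iotaP).
  - by move=> q q0; apply: chg_unit; rewrite chg_aug_int intr_eq0.
  - exact: alphaP.
have ea : chg_aug (phi alpha) != 0 by rewrite chg_aug_int alpha1 oner_eq0.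
have [u au] := chg_unit ea.
split.
- by apply: (@invertible_det _ _ t u); rewrite dt.
- by apply: (@invertible_det _ _ _ u); rewrite det_scalar1.
(* Row reduction leaves only the determinant, so [F] witnesses equality in K_1 at the size of [t]
   itself. *)
have [|F Fe tF] := @elementary_det_reduction _ _ (@chg_aug HZ) (@chg_unit _) _ t.
  by rewrite dt.
exists (tors_size (cd_rank E) (tr_m T)), F; split => //.
by rewrite stab_id {1}tF dt.
Qed.
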